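(* Let $X\subset\mathbb C^4$ be an affine algebraic variety of degree $d$ and dimension one or two, and let $P,Q\subset\mathbb C^2$ be finite sets, where we regard $P\times Q\subset\mathbb C^2\times\mathbb C^2=\mathbb C^4$. Then \[|X\cap(P\times Q)|=O_d(|P|+|Q|),\] unless $X$ is Cartesian.
   Context: Coordinates on $\mathbb C^4$ are $(x,y,s,t)$. Given $G\in\mathbb C[x,y]\setminus\mathbb C$ and $K\in\mathbb C[s,t]\setminus\mathbb C$, a polynomial $F\in\mathbb C[x,y,s,t]$ is called $(G,K)$-Cartesian if $F=G(x,y)H(x,y,s,t)+K(s,t)L(x,y,s,t)$ for some $H,L\in\mathbb C[x,y,s,t]$. A variety $X\subset\mathbb C^4$ with defining ideal $I(X)=\{F\in\mathbb C[x,y,s,t]: F\text{ vanishes on }X\}$ is Cartesian if there exist $G\in\mathbb C[x,y]\setminus\mathbb C$ and $K\in\mathbb C[s,t]\setminus\mathbb C$ such that every $F\in I(X)$ is $(G,K)$-Cartesian. (A variety may be reducible with components of different dimensions; its dimension is the maximum over components.) The notation $O_d(\cdot)$ means the implied constant depends only on $d$. *)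

(* Defs.v *)
From HB Require Import structures.
From mathcomp Require Import all_boot all_order all_algebra.
From mathcomp Require Import mpoly.
From mathcomp Require Import complex.
From Stdlib Require Rdefinitions.
From mathcomp Require Import Rstruct.
Import ComplexField.

Set Implicit Arguments.
Unset Strict Implicit.
Unset Printing Implicit Defensive.

Import Order.TTheory GRing.Theory Num.Theory.
Local Open Scope ring_scope.

Notation C := (complex Rdefinitions.R).

(* Points of C^4, coordinates (x,y,s,t) = indices 0,1,2,3. *)
Definition pt := 'rV[C]_4.

Definition peval (F : {mpoly C[4]}) (v : pt) : C := F.@[fun i => v 0 i].

Definition subset4 (A B : pt -> Prop) := forall x, A x -> B x.
Definition ssubset4 (A B : pt -> Prop) := subset4 A B /\ exists x, B x /\ ~ A x.

Definition zero_set (fs : seq {mpoly C[4]}) : pt -> Prop :=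
  fun x => all (fun f => peval f x == 0) fs.

Definition algset (S : pt -> Prop) : Prop :=
  exists fs : seq {mpoly C[4]}, forall x, S x <-> zero_set fs x.

Definition irreducible (S : pt -> Prop) : Prop :=
  [/\ algset S, (exists x, S x) &
    forall A B, algset A -> algset B -> (forall x, S x <-> A x \/ B x) ->
      subset4 S A \/ subset4 S B].

Definition chain_in (S : pt -> Prop) (k : nat) : Prop :=
  exists Z : nat -> pt -> Prop,
    (forall i, (i <= k)%N -> irreducible (Z i) /\ subset4 (Z i) S) /\
    (forall i, (i < k)%N -> ssubset4 (Z i) (Z i.+1)).

(* Dimension of an algebraic set (maximum over components = length of longest
   chain of irreducible closed subsets). *)
Definition has_dim (S : pt -> Prop) (k : nat) : Prop :=
  chain_in S k /\ ~ chain_in S k.+1.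

Definition aff_sub (k : nat) (A : 'M[C]_(k, 4)) (b : 'cV[C]_k) : pt -> Prop :=
  fun x => A *m x^T = b.

Definition finite_card (S : pt -> Prop) (n : nat) : Prop :=
  exists s : seq pt, [/\ uniq s, size s = n & forall x, S x <-> x \in s].

(* Degree of an irreducible algebraic set Y of dimension k: the maximal
   (= generic) number of points of Y ∩ L, over affine subspaces L of
   complementary dimension 4 - k meeting Y in finitely many points. *)
Definition irr_degree (Y : pt -> Prop) (k e : nat) : Prop :=
  (exists (A : 'M[C]_(k, 4)) (b : 'cV[C]_k),
      \rank A = k /\ finite_card (fun x => Y x /\ aff_sub A b x) e) /\
  (forall (A : 'M[C]_(k, 4)) (b : 'cV[C]_k) (n : nat),
      \rank A = k -> finite_card (fun x => Y x /\ aff_sub A b x) n -> (n <= e)%N).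

(* Degree of an algebraic set: sum of the degrees of its irreducible components
   (the irredundant decomposition into irreducible algebraic sets). *)
Definition has_degree (X : pt -> Prop) (d : nat) : Prop :=
  exists (n : nat) (Y : nat -> pt -> Prop) (k e : nat -> nat),
    [/\ forall i, (i < n)%N -> irreducible (Y i) /\ has_dim (Y i) (k i)
                              /\ irr_degree (Y i) (k i) (e i),
        forall x, X x <-> exists2 i, (i < n)%N & Y i x,
        forall i j, (i < n)%N -> (j < n)%N -> i <> j -> ~ subset4 (Y i) (Y j)
      & d = (\sum_(i < n) e i)%N].

Definition in_ideal (X : pt -> Prop) (F : {mpoly C[4]}) : Prop :=
  forall x, X x -> peval F x = 0.

Definition only_xy (G : {mpoly C[4]}) : Prop :=
  forall m, m \in msupp G -> m (inord 2 : 'I_4) = 0%N /\ m (inord 3 : 'I_4) = 0%N.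
Definition only_st (K : {mpoly C[4]}) : Prop :=
  forall m, m \in msupp K -> m (inord 0 : 'I_4) = 0%N /\ m (inord 1 : 'I_4) = 0%N.
Definition nonconstant (G : {mpoly C[4]}) : Prop := ~ exists c : C, G = c%:MP.

Definition GK_cartesian (G K F : {mpoly C[4]}) : Prop :=
  exists H L : {mpoly C[4]}, F = G * H + K * L.

Definition cartesian (X : pt -> Prop) : Prop :=
  exists G K : {mpoly C[4]},
    [/\ only_xy G, nonconstant G, only_st K, nonconstant K &
        forall F, in_ideal X F -> GK_cartesian G K F].

Definition pt_of (p q : C * C) : pt :=
  \row_(i < 4) (if (i : nat) == 0%N then p.1 else if (i : nat) == 1%N then p.2
                else if (i : nat) == 2%N then q.1 else q.2).

Definition incidences (fs : seq {mpoly C[4]}) (P Q : seq (C * C)) : nat :=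
  count (fun pq : (C * C) * (C * C) => all (fun f => peval f (pt_of pq.1 pq.2) == 0) fs)
        [seq (p, q) | p <- P, q <- Q].

(* Main.v *)
Require Import Defs.
From HB Require Import structures.
From mathcomp Require Import all_boot all_order all_algebra.
From mathcomp Require Import mpoly complex.
From mathcomp Require Import Rstruct.
From mathcomp Require Import ring zify perm polyXY separable.
From Stdlib Require Import Classical ClassicalEpsilon.
Import ComplexField.

Set Implicit Arguments.
Unset Strict Implicit.
Unset Printing Implicit Defensive.
Import GRing.Theory.
Local Open Scope ring_scope.

(** A variety is a union of boundedly many irreducible components (each has
positive degree), so it suffices to treat one component [Y], of dimension 2 in
the main case.  If the coordinates [x], [y] are algebraically independent on
[Y], then a finite fibre of the projection to [(x, y)] has at most [deg Y]
points, being a linear section.  The points [p] with an infinite fibre are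
boundedly many: if, say, [s] takes infinitely many values on the fibre, then
[p] is a common zero of all the coefficients (with respect to [s]) of the
minimal relation [A (x, y, s) = 0] on [Y]; generic sections parallel to the
coordinate planes bound the degrees of [A] by [deg Y], and the resultant of [A]
and a specialisation [A (x, y, mu)] bounds the number of common zeros.
The case where [s], [t] are independent is symmetric.  Otherwise [Y] is
contained in the product [T] of its two projections; [I(T)] is prime, a
dimension count gives [I(Y) = I(T)], and [I(T)] is generated by a polynomial in
[x], [y] and a polynomial in [s], [t], so that the variety is Cartesian. *)

(** One component decides: a polynomial vanishing on [X] vanishes on each component, so a Cartesian
    component makes [X] Cartesian. Hence, when [X] is not Cartesian, every component of dimension
    two has x, y or s, t independent. Degree is given only through finite linear sections and
    dimension only through chains, so both have to be turned into algebra. Vanishing ideals are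
    pulled back to rings of iterated univariate polynomials, where pseudo-division eliminates one
    variable at a time: three independent coordinates produce a long chain, and dependence of every
    pair forbids one. The resultant needs bounds on the degree of the relation in two variables at
    once, whereas a section bounds only a relation minimal in one of them. Gauss's lemma carries the
    second bound over to the same relation. *)

Lemma exists_minimal (T : Type) (Q : T -> Prop) (f : T -> nat) :
  (exists x, Q x) -> exists x, Q x /\ forall y, Q y -> (f x <= f y)%N.
Proof.
case=> x0 Qx0; apply: NNPP => nomin.
suff: forall n x, (f x < n)%N -> ~ Q x by move/(_ (f x0).+1 x0 (ltnSn _)).
elim=> // n IHn x; rewrite ltnS => fxn Qx; apply: nomin; exists x; split=> // y Qy.
rewrite leqNgt; apply/negP=> fyx; exact: IHn (leq_trans fyx fxn) Qy.
Qed.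

(** * Prime ideals, as predicates *)

Definition prime_pred (R : comNzRingType) (P : R -> Prop) : Prop :=
  [/\ P 0, ~ P 1, forall a b, P a -> P b -> P (a + b),
      forall a b, P b -> P (a * b) & forall a b, P (a * b) -> P a \/ P b].

Section PrimePred.
Variables (R : comNzRingType) (P : R -> Prop).
Hypothesis Pp : prime_pred P.

Lemma prime_pred0 : P 0. Proof. by case: Pp. Qed.
Lemma prime_pred1 : ~ P 1. Proof. by case: Pp. Qed.
Lemma prime_predD a b : P a -> P b -> P (a + b). Proof. by case: Pp => _ _ + _ _; apply. Qed.
Lemma prime_predMl a b : P b -> P (a * b). Proof. by case: Pp => _ _ _ + _; apply. Qed.
Lemma prime_predMr a b : P a -> P (a * b). Proof. by rewrite mulrC; exact: prime_predMl. Qed.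
Lemma prime_predN a : P a -> P (- a).
Proof. by rewrite -mulN1r; exact: prime_predMl. Qed.
Lemma prime_predB a b : P a -> P b -> P (a - b).
Proof. by move=> Pa /prime_predN; exact: prime_predD. Qed.
Lemma prime_pred_prime a b : P (a * b) -> P a \/ P b. Proof. by case: Pp => _ _ _ _; apply. Qed.
Lemma prime_predMn a b : ~ P a -> ~ P b -> ~ P (a * b).
Proof. by move=> Pa Pb /prime_pred_prime[]. Qed.
Lemma prime_predXn a n : ~ P a -> ~ P (a ^+ n).
Proof.
by move=> Pa; elim: n => [|n IHn]; [exact: prime_pred1 | rewrite exprS; exact: prime_predMn].
Qed.
End PrimePred.

Lemma prime_pred_polyC (R : comNzRingType) (P : {poly R} -> Prop) :
  prime_pred P -> prime_pred (fun a => P a%:P).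
Proof.
case=> P0 P1 PD PM PP; split=> //.
- by move=> a b Pa Pb; rewrite polyCD; exact: PD.
- by move=> a b Pb; rewrite polyCM; exact: PM.
- by move=> a b; rewrite polyCM; exact: PP.
Qed.

Lemma pseudo_division (R : idomainType) (H F : {poly R}) : F != 0 ->
  exists N Q r, lead_coef F ^+ N *: H = Q * F + r /\ (size r < size F)%N.
Proof.
move=> F0; exists (scalp H F), (H %/ F)%R, (H %% F)%R; split; last by rewrite ltn_modp.
exact: Pdiv.Idomain.divp_eq.
Qed.

(** * Adjoining one element modulo a prime ideal *)

Section Elimination.
Variables (R : idomainType) (P : {poly R} -> Prop).
Hypothesis Pp : prime_pred P.
Local Notation P0 a := (P a%:P).
Let P0p : prime_pred (fun a => P0 a). Proof. exact: prime_pred_polyC. Qed.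

Lemma prime_pred_coefs (r : {poly R}) : (forall i, P0 r`_i) -> P r.
Proof.
move=> Pr; rewrite -[r]coefK poly_def; apply: (big_ind P) => [||i _].
- exact: prime_pred0.
- by move=> a b; exact: prime_predD.
- by rewrite -mul_polyC; apply: prime_predMr => //; apply: Pr.
Qed.

Lemma strip_lead (H : {poly R}) : P0 (lead_coef H) -> H != 0 ->
  exists H' : {poly R}, [/\ (size H' < size H)%N, P (H - H') &
    (forall i, P0 H'`_i) -> forall i, P0 H`_i].
Proof.
move=> PlH H0; have sH : size H = (size H).-1.+1 by rewrite prednK // size_poly_gt0.
pose M := lead_coef H *: 'X^((size H).-1); exists (H - M); split.
- rewrite sH ltnS; apply/leq_sizeP => j; rewrite leq_eqVlt => /orP[/eqP <-|lt].
    by rewrite !coefE eqxx mulr1 -lead_coefE subrr.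
  rewrite !coefE gtn_eqF // mulr0 subr0; apply/leq_sizeP: lt; by rewrite -sH.
- by rewrite opprB addrC subrK /M -mul_polyC; apply: prime_predMr.
- move=> PH' i; have := PH' i; rewrite !coefE.
  case: eqP => [->|_]; last by rewrite mulr0 subr0.
  by rewrite -lead_coefE.
Qed.

(** The dichotomy between transcendental and algebraic: leading terms with coefficient in [P0] are
    removed until nothing is left or a genuine relation appears. *)
Lemma strip_coefs (H : {poly R}) : P H -> (forall i, P0 H`_i) \/
  exists H', [/\ P H', ~ P0 (lead_coef H') & (size H' <= size H)%N].
Proof.
have [n] := ubnP (size H); elim: n H => // n IHn H; rewrite ltnS => sH PH.
have [->|H0] := eqVneq H 0; first by left=> i; rewrite coef0; exact: (prime_pred0 P0p).
case: (classic (P0 (lead_coef H))) => [PlH|]; last by right; exists H.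
have [H' [sH' PHH' cH']] := strip_lead PlH H0.
have PH' : P H' by rewrite -(subKr H H'); exact: prime_predB.
case: (IHn H' (leq_trans sH' sH) PH') => [/cH'|[K [? ? sK]]]; first by left.
by right; exists K; split=> //; apply: leq_trans sK (ltnW sH').
Qed.

(** The counterpart of the minimal polynomial of ['X] over the fraction field of [R] modulo [P0];
    only relations whose leading coefficient survives in that field compete. *)
Definition min_relation (F : {poly R}) := [/\ P F, ~ P0 (lead_coef F) &
  forall H, P H -> ~ P0 (lead_coef H) -> (size F <= size H)%N].

Lemma min_relation_exists F : P F -> ~ P0 (lead_coef F) -> exists F', min_relation F'.
Proof.
move=> PF lF; have [|F' [[? ?] m]] :=
  @exists_minimal _ (fun F => P F /\ ~ P0 (lead_coef F)) (fun F => size F).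
  by exists F.
by exists F'; split=> // H ? ?; apply: m.
Qed.

Lemma min_relation_neq0 F : min_relation F -> F != 0.
Proof. by case=> _ l _; apply/eqP=> F0; apply: l; rewrite F0 lead_coef0; exact: (prime_pred0 P0p). Qed.

Lemma min_relation_size F : min_relation F -> (1 < size F)%N.
Proof.
case=> PF l _; rewrite ltnNge; apply/negP => /size1_polyC F1; apply: l.
by rewrite F1 lead_coefC -F1.
Qed.

Lemma min_relation_divides F H : min_relation F -> P H ->
  exists N Q r, lead_coef F ^+ N *: H = Q * F + r /\ forall i, P0 r`_i.
Proof.
move=> mF PH; have F0 := min_relation_neq0 mF; have [PF lF mm] := mF.
have [N [Q [r [E sr]]]] := pseudo_division H F0.
exists N, Q, r; split=> //.
have Pr : P r.
  have -> : r = lead_coef F ^+ N *: H - Q * F by rewrite E addrC addKr.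
  by apply: prime_predB => //; [rewrite -mul_polyC|]; apply: prime_predMl.
case: (strip_coefs Pr) => // -[H' [PH' lH' sH']].
by have := leq_trans (mm _ PH' lH') sH'; rewrite leqNgt sr.
Qed.

(** In an algebraic extension every nonzero [g] divides a nonzero element of the base. Among the
    multiples of [g] modulo [P] that are not in [P], one of least size must be constant, since
    otherwise dividing the minimal relation by it gives a shorter relation. *)
Lemma relation_unit F g : P F -> ~ P0 (lead_coef F) -> ~ P g ->
  exists v r, ~ P0 r /\ P (r%:P - v * g).
Proof.
move=> PF1 lF1 Pg; have {F PF1 lF1} [F mF] := min_relation_exists PF1 lF1.
have F0 := min_relation_neq0 mF; have [PF lF mm] := mF.
pose S h := ~ P h /\ exists v, P (h - v * g).
have [|h [[Ph [v Pv]] mh]] := @exists_minimal _ S (fun h => size h).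
  by exists g; split=> //; exists 1; rewrite mul1r subrr; exact: prime_pred0.
have h0 : h != 0 by apply/eqP => h0; apply: Ph; rewrite h0; exact: prime_pred0.
have lh : ~ P0 (lead_coef h).
  move=> /strip_lead -/(_ h0) [h' [sh' Ph' _]].
  suff /mh : S h' by rewrite leqNgt sh'.
  split=> [Ph1|]; first by apply: Ph; rewrite -(subrK h' h); exact: prime_predD.
  exists v; rewrite (_ : _ - _ = (h - v * g) - (h - h')); last by ring.
  exact: prime_predB.
(* Pseudo-division by [F] multiplies [h] by an element outside [P0], so the remainder is again a
   multiple of [g] outside [P]. *)
have shF : (size h < size F)%N.
  have [N [Q [r [E sr]]]] := pseudo_division h F0.
  apply: leq_ltn_trans sr; apply: mh.
  have Er : r = (lead_coef F ^+ N)%:P * h - Q * F by rewrite mul_polyC E addrC addKr.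
  split=> [Pr|].
    have : P ((lead_coef F ^+ N)%:P * h).
      by rewrite mul_polyC E; apply: prime_predD => //; apply: prime_predMl.
    by move=> /(prime_pred_prime Pp) [] //; apply: (prime_predXn P0p).
  exists ((lead_coef F ^+ N)%:P * v).
  rewrite Er (_ : _ - _ = (lead_coef F ^+ N)%:P * (h - v * g) - Q * F); last by ring.
  by apply: prime_predB => //; apply: prime_predMl.
have [sh|sh] := leqP (size h) 1.
  exists v, (lead_coef h); split=> //.
  by rewrite {1}(size1_polyC sh) lead_coefC -(size1_polyC sh).
have [N [Q [r [E sr]]]] := pseudo_division F h0.
have Pr : P r.
  apply: NNPP => nPr; suff /mh : S r by rewrite leqNgt sr.
  split=> //; exists (- Q * v).
  have -> : r - - Q * v * g = (lead_coef h ^+ N)%:P * F - Q * (h - v * g).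
    by rewrite mul_polyC E; ring.
  by apply: prime_predB => //; apply: prime_predMl.
(* [Q * h] lies in [P] and [h] does not, so [Q] is a relation. It is shorter than [F] because [h] is
   nonconstant, yet its leading coefficient survives modulo [P0]: a contradiction. *)
have PQ : P Q.
  have : P (Q * h).
    have -> : Q * h = (lead_coef h ^+ N)%:P * F - r by rewrite mul_polyC E addrK.
    by apply: prime_predB => //; apply: prime_predMl.
  by move=> /(prime_pred_prime Pp) [].
have lhN : lead_coef h ^+ N != 0 by rewrite expf_neq0 // lead_coef_eq0.
have sQ : (size (Q * h)) = size F.
  have -> : Q * h = lead_coef h ^+ N *: F - r by rewrite E addrK.
  rewrite size_polyDl size_scale // size_polyN; exact: ltn_trans sr shF.
have lQ : lead_coef Q * lead_coef h = lead_coef h ^+ N * lead_coef F.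
  rewrite -lead_coefM -lead_coefZ; have -> : Q * h = lead_coef h ^+ N *: F - r by rewrite E addrK.
  rewrite lead_coefDl // size_polyN size_scale //; exact: ltn_trans sr shF.
have Q0 : Q != 0.
  by apply/eqP => Q0; move: sQ; rewrite Q0 mul0r size_poly0 => /esym/eqP; rewrite size_poly_eq0 (negPf F0).
have : (size F <= size Q)%N.
  apply: mm => // PlQ.
  have: P0 (lead_coef h ^+ N * lead_coef F) by rewrite -lQ; apply: (prime_predMr P0p).
  by move/(prime_pred_prime P0p) => [] //; apply: (prime_predXn P0p).
by rewrite -sQ size_mul // -subn1 -addnBA ?(ltnW sh) // -{2}[size Q]addn0 leq_add2l subn1 leqNgt -ltnS prednK ?sh // ltnW.
Qed.
End Elimination.

(** * Lifting points along a generic projection *)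

Section Extension.
Variables (R : comNzRingType) (K : comNzRingType) (chi : {rmorphism R -> K}) (tau : K).
Definition ext : {rmorphism {poly R} -> K} := horner_eval tau \o map_poly chi.
Lemma extE F : ext F = (map_poly chi F).[tau]. Proof. by []. Qed.
Lemma extC a : ext a%:P = chi a. Proof. by rewrite extE map_polyC hornerC. Qed.
Lemma extX : ext 'X = tau. Proof. by rewrite extE map_polyX hornerX. Qed.
End Extension.

Section ExtendPoint.
Variables (R : idomainType) (P : {poly R} -> Prop) (K : closedFieldType).
Hypothesis Pp : prime_pred P.
Local Notation P0 a := (P a%:P).

Lemma ext_coefs (chi : {rmorphism R -> K}) tau (r : {poly R}) :
  (forall a, P0 a -> chi a = 0) -> (forall i, P0 r`_i) -> ext chi tau r = 0.
Proof.
move=> kP Pr; rewrite extE (_ : map_poly chi r = 0) ?horner0 //.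
by apply/polyP=> i; rewrite coef_map coef0 /=; apply: kP.
Qed.

(** A power of [lead_coef F] times [H] is a multiple of [F] up to coefficients in [P0]; where that
    leading coefficient survives, a root of [F] therefore kills all of [P]. *)
Lemma min_relation_root F (chi : {rmorphism R -> K}) tau :
  min_relation P F -> (forall a, P0 a -> chi a = 0) -> chi (lead_coef F) != 0 ->
  ext chi tau F = 0 -> forall H, P H -> ext chi tau H = 0.
Proof.
move=> mF kP lF rF H PH.
have [N [Q [r [E Pr]]]] := min_relation_divides Pp mF PH.
have : ext chi tau (lead_coef F ^+ N *: H) = 0.
  by rewrite E rmorphD rmorphM rF mulr0 add0r; apply: ext_coefs.
rewrite -mul_polyC rmorphM extC rmorphXn => /eqP.
by rewrite mulf_eq0 expf_eq0 (negPf lF) andbF /= => /eqP.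
Qed.

(** Chevalley's theorem in the form needed: off the zeros of some [D], a point of the base extends
    to a zero of [P] at which [g] does not vanish. *)
Lemma extend_point g : ~ P g -> exists D, ~ P0 D /\
  forall chi : {rmorphism R -> K}, (forall a, P0 a -> chi a = 0) -> chi D != 0 ->
  exists tau, (forall H, P H -> ext chi tau H = 0) /\ ext chi tau g != 0.
Proof.
move=> Pg; have P0p := prime_pred_polyC Pp.
case: (classic (exists F, P F /\ ~ P0 (lead_coef F))) => [[F1 [PF1 lF1]]|indep].
  have [F mF] := min_relation_exists PF1 lF1; have [PF lF _] := mF.
  have [v [r [Pr Pvr]]] := relation_unit Pp PF lF Pg.
  (* The first factor keeps a root of [F] available; the second, a multiple of [g] modulo [P], keeps
     [g] nonzero at that root. *)
  exists (lead_coef F * r); split; first exact: (prime_predMn P0p).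
  move=> chi kP; rewrite rmorphM mulf_eq0 negb_or => /andP[lFc rc].
  have : size (map_poly chi F) != 1 by rewrite size_map_poly_id0 // gtn_eqF // (min_relation_size mF).
  move/closed_rootP => [tau /rootP rt]; exists tau.
  have kH := min_relation_root mF kP lFc rt; split=> //.
  have /eqP := kH _ Pvr; rewrite rmorphB rmorphM extC subr_eq0 => /eqP rE.
  by apply: contraNneq rc => g0; rewrite rE g0 mulr0.
(* Transcendental case: every member of [P] has all its coefficients in [P0], so any [tau] that is
   not a root of the specialised [g] will do. *)
have ind H : P H -> forall i, P0 H`_i.
  by move=> /(strip_coefs Pp) [] // -[H' [PH' lH' _]]; case: indep; exists H'.
have [i Pgi] : exists i, ~ P0 g`_i.
  by apply: not_all_ex_not => /(prime_pred_coefs Pp).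
exists g`_i; split=> // chi kP gi.
have : map_poly chi g != 0.
  by apply: contraNneq gi => g0; have := coef_map chi g i; rewrite g0 coef0 => <-.
move/closed_nonrootP => [tau rt]; exists tau; split=> // H PH.
by apply: ext_coefs => // j; apply: ind.
Qed.
End ExtendPoint.

(** * Gauss's lemma over the fraction field of a domain *)

Section Gauss.
Variable D : idomainType.
Implicit Types (F Q A : {poly {poly D}}) (p : {poly D}).

Lemma sizeYM Q F : Q != 0 -> F != 0 -> sizeY (Q * F) = (sizeY Q + sizeY F).-1.
Proof. by move=> Q0 F0; rewrite !sizeYE rmorphM size_mul ?swapXY_eq0. Qed.

Lemma sizeYC p : sizeY p%:P = size p.
Proof. by rewrite sizeYE swapXY_polyC size_map_polyC. Qed.

(** Division of all coefficients of [Q] by [p] at once. The common denominator [c] is a constant, a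
    unit in the fraction field of [D]. *)
Lemma pseudo_division_coefs p Q : p != 0 -> exists (c : D) Q1 Q2,
  [/\ c != 0, c%:P%:P * Q = p%:P * Q1 + Q2 & forall i, (size (Q2`_i)%R < size p)%N].
Proof.
move=> p0; elim/poly_ind: Q => [|Q q [c [Q1 [Q2 [c0 E s]]]]].
  exists 1, 0, 0; split=> [||i]; rewrite ?oner_eq0 ?mulr0 ?addr0 //.
  by rewrite coef0 size_poly0 size_poly_gt0.
have [N [u [r [Eq sr]]]] := pseudo_division q p0.
pose l := lead_coef p ^+ N; have l0 : l != 0 by rewrite expf_neq0 // lead_coef_eq0.
have {}Eq : l%:P * q = u * p + r by rewrite mul_polyC.
exists (l * c), (l%:P%:P * Q1 * 'X + (c%:P * u)%:P), (l%:P%:P * Q2 * 'X + (c%:P * r)%:P); split.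
- by rewrite mulf_neq0.
- rewrite !polyCM; transitivity (l%:P%:P * (c%:P%:P * Q) * 'X + c%:P%:P * (l%:P%:P * q%:P)).
    by ring.
  by rewrite E -[l%:P%:P * q%:P]polyCM Eq !polyCD !polyCM; ring.
- move=> i; rewrite coefD coefMX coefC.
  by case: i => [|i] /=; rewrite ?add0r ?addr0 ?coefCM mul_polyC size_scale.
Qed.

Let divides_upto_const (h a : {poly D}) := exists (c : D) u, c != 0 /\ c%:P * a = h * u.

(** Euclid's lemma over the fraction field of [D]: a nonconstant divisor [p] of least degree is
    irreducible, so it cannot divide a product of two shorter nonzero factors. A shortest [h] with
    [p] dividing [h * f] either leaves a shorter remainder of [p], or divides [p] and hence [a], or
    is constant, and then [p] would divide [f]. *)
Lemma min_divisor_prime (a p q f : {poly D}) (c : D) (w : {poly D}) :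
  (forall h : {poly D}, (1 < size h)%N -> divides_upto_const h a -> (size p <= size h)%N) ->
  divides_upto_const p a -> q != 0 -> f != 0 -> c != 0 ->
  (size q < size p)%N -> (size f < size p)%N -> c%:P * q * f = p * w -> False.
Proof.
move=> minp [c1 [u1 [c10 E1]]] q0 f0 c0 sq sf E.
pose S (h : {poly D}) := [/\ h != 0, (size h < size p)%N &
  exists (c : D) w, c != 0 /\ c%:P * h * f = p * w].
have [|h [[h0 sh [c2 [w2 [c20 E2]]]] mh]] := @exists_minimal _ S (fun h => size h).
  by exists q; split=> //; exists c, w.
have p0 : p != 0 by rewrite -size_poly_gt0; apply: leq_ltn_trans sq.
have [sh1|sh1] := leqP (size h) 1.
  have h1 : h`_0 != 0 by rewrite -polyC_eq0 -(size1_polyC sh1).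
  move: E2; rewrite (size1_polyC sh1) -polyCM mul_polyC => E2.
  have ww : w2 != 0.
    apply: contraNneq f0 => w0; move: E2; rewrite w0 mulr0 => /eqP.
    by rewrite -!size_poly_eq0 size_scale // mulf_neq0.
  have := sf; rewrite -(@size_scale _ (c2 * h`_0)) ?mulf_neq0 // E2 size_mul //.
  by rewrite -(prednK (_ : 0 < size w2)%N) ?size_poly_gt0 // addnS /= ltnNge leq_addr.
have [N [u [r [Er sr]]]] := pseudo_division p h0.
have l0 : lead_coef h ^+ N != 0 by rewrite expf_neq0 // lead_coef_eq0.
have [r0|r0] := eqVneq r 0; last first.
  have /mh : S r; last by rewrite leqNgt sr.
  split=> //; first exact: ltn_trans sr sh.
  exists c2, (c2%:P * (lead_coef h ^+ N)%:P * f - u * w2); split=> //.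
  have -> : r = (lead_coef h ^+ N)%:P * p - u * h by rewrite mul_polyC Er addrC addKr.
  have -> : c2%:P * ((lead_coef h ^+ N)%:P * p - u * h) * f =
     c2%:P * (lead_coef h ^+ N)%:P * p * f - u * (c2%:P * h * f) by ring.
  by rewrite E2; ring.
have /(minp _ sh1) : divides_upto_const h a; last by rewrite leqNgt sh.
exists (lead_coef h ^+ N * c1), (u * u1); split; first by rewrite mulf_neq0.
rewrite polyCM -mulrA E1 mulrA mul_polyC Er r0; ring.
Qed.

Variables (P : {poly {poly D}} -> Prop) (A : {poly {poly D}}).
Hypothesis Pp : prime_pred P.
Hypothesis P0 : forall p, P p%:P -> p = 0.
Hypotheses (PA : P A) (A0 : A != 0).
Hypothesis minA : forall F, P F -> F != 0 -> (size A <= size F)%N.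
Hypothesis minYA : forall F, P F -> F != 0 -> size F = size A -> (sizeY A <= sizeY F)%N.

(* A divisor [p] of the denominator [a] of minimal degree is prime up to constants, so it
   divides [Q], and can be cancelled, or [A], against minimality. *)
Lemma gauss_divides F : P F -> exists (c : D) Q, c != 0 /\ c%:P%:P * F = Q * A.
Proof.
move=> PF; have [N [Q [r [E sr]]]] := pseudo_division F A0.
have r0 : r = 0.
  apply/eqP; apply/negPn/negP => r0; have: P r.
    have -> : r = (lead_coef A ^+ N)%:P * F - Q * A by rewrite mul_polyC E addrC addKr.
    by apply: prime_predB => //; apply: prime_predMl.
  by move/minA => /(_ r0); rewrite leqNgt sr.
move: E; rewrite r0 addr0 -mul_polyC.
have: lead_coef A ^+ N != 0 by rewrite expf_neq0 // lead_coef_eq0.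
move: (_ ^+ N) => a {r r0 sr N}.
have [n] := ubnP (size a); elim: n a Q => // n IHn a Q; rewrite ltnS => sa a0 E.
have [sa1|sa1] := leqP (size a) 1.
  exists a`_0, Q; rewrite -polyC_eq0 -(size1_polyC sa1) E; split=> //.
have [|p [[sp [d [u [d0 Ed]]]] minp]] := @exists_minimal _
    (fun h : {poly D} => (1 < size h)%N /\ divides_upto_const h a) (fun h => size h).
  by exists a; split=> //; exists 1, 1; rewrite oner_eq0 mul1r mulr1.
have p0 : p != 0 by rewrite -size_poly_gt0 ltnW.
have [c1 [Q1 [Q2 [c10 E1 s1]]]] := pseudo_division_coefs Q p0.
have [c2 [A1 [A2 [c20 E2 s2]]]] := pseudo_division_coefs A p0.
(* Here [p] divides every coefficient of [Q]; cancelling it leaves the shorter denominator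
   [c1%:P * u]. *)
have [Q20|Q20] := eqVneq Q2 0.
  move: E1; rewrite Q20 addr0 => E1.
  apply: (IHn (c1%:P * u) (d%:P%:P * Q1)).
  - have u0 : u != 0.
      apply: contraNneq a0 => u0; move: Ed; rewrite u0 mulr0 => /eqP.
      by rewrite mulf_eq0 polyC_eq0 (negPf d0).
    have := congr1 (fun f : {poly D} => size f) Ed.
    rewrite mul_polyC size_scale // size_mul // mul_polyC size_scale // => sE.
    apply: leq_trans sa; rewrite sE -(prednK (ltnW sp)) addSn /= -{1}[size u]add0n ltn_add2r.
    by rewrite -ltnS (prednK (ltnW sp)).
  - rewrite mulf_neq0 ?polyC_eq0 //; apply: contraNneq a0 => u0; move: Ed; rewrite u0 mulr0 => /eqP.
    by rewrite mulf_eq0 polyC_eq0 (negPf d0).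
  - apply: (@mulfI _ p%:P); first by rewrite polyC_eq0.
    transitivity (c1%:P%:P * (p * u)%:P * F); first by rewrite !polyCM; ring.
    rewrite -Ed polyCM; transitivity (d%:P%:P * (c1%:P%:P * (a%:P * F))); first by ring.
    rewrite E; transitivity (d%:P%:P * (c1%:P%:P * Q) * A); first by ring.
    by rewrite E1; ring.
have [A20|A20] := eqVneq A2 0.
  exfalso; move: E2; rewrite A20 addr0 => E2.
  have A10 : A1 != 0.
    apply: contraNneq A0 => A10; move: E2; rewrite A10 mulr0 => /eqP.
    by rewrite mulf_eq0 !polyC_eq0 (negPf c20).
  have PA1 : P A1.
    have : P (p%:P * A1) by rewrite -E2; apply: prime_predMl.
    by move/(prime_pred_prime Pp) => [] // /P0 p00; rewrite p00 eqxx in p0.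
  have sA1 : size A1 = size A.
    have := congr1 (fun f : {poly {poly D}} => size f) E2.
    by rewrite !mul_polyC !size_scale ?polyC_eq0.
  have := minYA PA1 A10 sA1; rewrite leqNgt => /negP; apply.
  have := congr1 (@sizeY _) E2.
  rewrite !sizeYM ?polyC_eq0 // !sizeYC size_polyC c20 add1n /= => ->.
  rewrite -(prednK (ltnW sp)) addSn /= -{1}[sizeY A1]add0n ltn_add2r.
  by rewrite -ltnS (prednK (ltnW sp)).
(* Modulo [p], neither [Q] nor [A] vanishes, but their product does; the product of the leading
   coefficients of the two remainders is then divisible by [p] up to a constant. *)
exfalso; pose w := lead_coef (c1%:P%:P * c2%:P%:P * u%:P * F
   - d%:P%:P * (Q1 * (p%:P * A1) + Q1 * A2 + Q2 * A1)).
apply: (@min_divisor_prime a p (lead_coef Q2) (lead_coef A2) d w) => //.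
- by move=> h ? ?; apply: minp.
- by exists d, u.
- by rewrite lead_coef_eq0.
- by rewrite lead_coef_eq0.
- by rewrite lead_coefE.
- by rewrite lead_coefE.
rewrite -mulrA -lead_coefM -(lead_coefC (d%:P)) -lead_coefM /w -(lead_coefC p) -lead_coefM.
congr lead_coef.
have -> : Q2 = c1%:P%:P * Q - p%:P * Q1 by rewrite E1 addrC addKr.
have -> : A2 = c2%:P%:P * A - p%:P * A1 by rewrite E2 addrC addKr.
transitivity (d%:P%:P * (c1%:P%:P * c2%:P%:P * (Q * A)
   - p%:P * (Q1 * (c2%:P%:P * A) + (c1%:P%:P * Q - p%:P * Q1) * A1))); first by ring.
rewrite -E; transitivity (c1%:P%:P * c2%:P%:P * (d%:P * a)%:P * F
   - d%:P%:P * p%:P * (Q1 * (c2%:P%:P * A) + (c1%:P%:P * Q - p%:P * Q1) * A1)).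
  by rewrite polyCM; ring.
by rewrite Ed polyCM lead_coefC; ring.
Qed.
End Gauss.

(** * Hilbert's basis theorem *)

Lemma dependent_choice (T : Type) (Q : T -> Prop) (r : T -> T -> Prop) x0 :
  Q x0 -> (forall x, Q x -> exists y, Q y /\ r x y) ->
  exists f : nat -> T, f 0%N = x0 /\ forall n, Q (f n) /\ r (f n) (f n.+1).
Proof.
move=> Q0 step.
have [g Hg] := choice (fun (x y : {x | Q x}) => r (sval x) (sval y))
  (fun x => let: ex_intro y (conj Qy rxy) := step (sval x) (svalP x) in
            ex_intro _ (exist _ y Qy) rxy).
exists (fun n => sval (iter n g (exist _ x0 Q0))); split=> // n.
by split; [exact: svalP | rewrite /=; exact: Hg].
Qed.

Definition lin_comb (R : comNzRingType) (L : seq R) (h : R) :=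
  exists c : nat -> R, h = \sum_(i < size L) c i * L`_i.

(** The ascending chain condition on finitely generated ideals, read off a sequence of generators:
    they cannot all be new. *)
Definition noetherian (R : comNzRingType) :=
  forall f : nat -> R, exists n, lin_comb (mkseq f n) (f n).

Section LinComb.
Variables (R : comNzRingType).
Implicit Types (L : seq R).

Lemma lin_comb0 L : lin_comb L 0.
Proof. by exists (fun=> 0); rewrite big1 // => i _; rewrite mul0r. Qed.

Lemma lin_combD L a b : lin_comb L a -> lin_comb L b -> lin_comb L (a + b).
Proof.
move=> [c ->] [d ->]; exists (fun i => c i + d i).
by rewrite -big_split; apply: eq_bigr => i _; rewrite mulrDl.
Qed.

Lemma lin_combM L a b : lin_comb L b -> lin_comb L (a * b).
Proof.
move=> [c ->]; exists (fun i => a * c i).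
by rewrite mulr_sumr; apply: eq_bigr => i _; rewrite mulrA.
Qed.

Lemma lin_comb_mem L a : a \in L -> lin_comb L a.
Proof.
move=> aL; exists (fun i => if i == index a L then 1 else 0).
have iL : (index a L < size L)%N by rewrite index_mem.
rewrite (bigD1 (Ordinal iL)) //= eqxx mul1r nth_index // big1 ?addr0 // => i ne.
case: eqP => [E|_]; last by rewrite mul0r.
by case/eqP: ne; apply: val_inj.
Qed.

Lemma lin_comb_trans L L' a :
  (forall b, b \in L -> lin_comb L' b) -> lin_comb L a -> lin_comb L' a.
Proof.
move=> LL' [c ->]; apply: big_ind => [||i _].
- exact: lin_comb0.
- exact: lin_combD.
- by apply: lin_combM; apply: LL'; rewrite mem_nth.
Qed.
End LinComb.

Lemma noetherian_field (K : fieldType) : noetherian K.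
Proof.
move=> f; have [f0|f0] := eqVneq (f 0%N) 0; first by exists 0%N; rewrite f0; apply: lin_comb0.
exists 1%N; exists (fun=> f 1%N / f 0%N); by rewrite big_ord1 /= divfK.
Qed.

(** A counterexample sequence is replaced by generators [G n] of its ideal, each of least degree
    outside the ideal of the earlier ones. The hypothesis on [R], applied to their leading
    coefficients, lowers the degree of one of them. *)
Theorem hilbert_basis (R : comNzRingType) : noetherian R -> noetherian {poly R}.
Proof.
move=> noethR f; apply: NNPP => nof.
have {}nof n : ~ lin_comb (mkseq f n) (f n) by move=> h; apply: nof; exists n.
pose I h := exists n, lin_comb (mkseq f n) h.
have mkf m n : (m <= n)%N -> forall b, b \in mkseq f m -> lin_comb (mkseq f n) b.
  move=> mn b /mapP[l]; rewrite mem_iota add0n => /andP[_ im] ->; apply: lin_comb_mem.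
  by apply: map_f; rewrite mem_iota add0n (leq_trans im mn).
have I_seq (L : seq {poly R}) : (forall h, h \in L -> I h) -> exists n, forall h, h \in L -> lin_comb (mkseq f n) h.
  elim: L => [|a L IHL] LI; first by exists 0%N.
  have [n Hn] := IHL (fun h hL => LI h (@mem_behead _ (a :: L) h hL)).
  have [m Hm] := LI a (mem_head _ _); exists (maxn m n) => h.
  rewrite inE => /orP[/eqP->|/Hn]; first apply: lin_comb_trans Hm.
    by apply: mkf; exact: leq_maxl.
  by apply: lin_comb_trans; apply: mkf; exact: leq_maxr.
have ID a b : I a -> I b -> I (a + b).
  move=> [m Hm] [n Hn]; exists (maxn m n); apply: lin_combD.
    by apply: lin_comb_trans Hm; apply: mkf; exact: leq_maxl.
  by apply: lin_comb_trans Hn; apply: mkf; exact: leq_maxr.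
have IM a b : I b -> I (a * b) by move=> [n Hn]; exists n; exact: lin_combM.
pose Q (L : seq {poly R}) := forall h, h \in L -> I h.
pose r (L L' : seq {poly R}) := exists g : {poly R}, [/\ L' = rcons L g, ~ lin_comb L g &
   forall h : {poly R}, I h -> ~ lin_comb L h -> (size g <= size h)%N].
have [|L QL|F [F0 HF]] := @dependent_choice _ Q r [::].
- by [].
- have [n Hn] := I_seq L QL.
  have [|g [[Ig Lg] mg]] := @exists_minimal _ (fun h => I h /\ ~ lin_comb L h) (fun h => size h).
    exists (f n); split; first by exists n.+1; apply: lin_comb_mem; apply: map_f; rewrite mem_iota add0n leqnn.
    by move=> Lf; apply: (nof n); apply: lin_comb_trans Lf.
  exists (rcons L g); split; last by exists g; split=> // h Ih Lh; apply: mg.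
  by move=> h; rewrite mem_rcons inE => /orP[/eqP->|/QL].
pose G n := last 0 (F n.+1).
have FG n : F n = mkseq G n.
  elim: n => [|n IHn]; first by rewrite F0.
  have [_ [g [E _ _]]] := HF n.
  by rewrite /mkseq -addn1 iotaD map_cat -/(mkseq G n) -IHn /= add0n /G addn1 E last_rcons cats1.
have HG n : [/\ I (G n), ~ lin_comb (mkseq G n) (G n) &
    forall h : {poly R}, I h -> ~ lin_comb (mkseq G n) h -> (size (G n) <= size h)%N].
  have [_ [g [E Lg mg]]] := HF n; have Gg : G n = g by rewrite /G E last_rcons.
  rewrite -FG Gg; split=> //; have [QF _] := HF n.+1; apply: QF.
  by rewrite E mem_rcons mem_head.
have sG i n : (i < n)%N -> (size (G i) <= size (G n))%N.
  move=> ilt; have [_ _ mi] := HG i; have [IG nG _] := HG n.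
  apply: mi => // Li; apply: nG; apply: lin_comb_trans Li => b /mapP[j].
  rewrite mem_iota add0n => /andP[_ ji] ->; apply: lin_comb_mem; apply: map_f.
  by rewrite mem_iota add0n (ltn_trans ji ilt).
have [n [c Ec]] := noethR (fun n => lead_coef (G n)).
have [IG nG mG] := HG n.
have Gn0 : G n != 0 by apply/eqP=> G0; apply: nG; rewrite G0; apply: lin_comb0.
(* The earlier generators, shifted to the degree of [G n] and weighted by [c], reproduce its leading
   term; so [G n - M] is too short to lie outside the ideal of the earlier ones. *)
pose M := \sum_(i < n) ((c i)%:P * 'X^(size (G n) - size (G i))) * G i.
have LM : lin_comb (mkseq G n) M.
  apply: big_ind => [||i _]; [exact: lin_comb0|exact: lin_combD|apply: lin_combM].
  by apply: lin_comb_mem; apply: map_f; rewrite mem_iota add0n /=.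
have IM' : I M.
  apply: big_ind => [||i _]; [exists 0%N; exact: lin_comb0|exact: ID|apply: IM].
  by have [] := HG i.
have : (size (G n) <= size (G n - M)%R)%N.
  apply: mG => [|LG]; first by apply: ID => //; rewrite -mulN1r; apply: IM.
  by apply: nG; rewrite -(subrK M (G n)); apply: lin_combD.
apply/negP; rewrite -ltnNge.
have sn : size (G n) = (size (G n)).-1.+1 by rewrite prednK // size_poly_gt0.
rewrite [X in (_ < X)%N]sn ltnS; apply/leq_sizeP => j; rewrite leq_eqVlt => /orP[/eqP <-|lt].
  rewrite coefB -lead_coefE Ec size_mkseq coef_sum.
  apply/eqP; rewrite subr_eq0; apply/eqP; apply: eq_bigr => i _.
  rewrite nth_mkseq // -mulrA coefCM; congr (_ * _).
  rewrite mulrC coefMXn; have si := sG i n (ltn_ord i).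
  have [Gi0|Gi0] := eqVneq (G i) 0; first by rewrite Gi0 lead_coef0 coef0 if_same.
  have si0 : (0 < size (G i))%N by rewrite size_poly_gt0.
  case: ltnP => [|_]; first by lia.
  rewrite lead_coefE; congr (_`__).
  by lia.
have hj : (size (G n) <= j)%N by lia.
rewrite coefB (nth_default _ hj) sub0r coef_sum big1 ?oppr0 // => i _.
rewrite -mulrA coefCM [_ * G i]mulrC coefMXn; have si := sG i n (ltn_ord i).
case: ltnP => _; first by rewrite mulr0.
rewrite nth_default ?mulr0 // leq_subRL ?subnK //.
exact: leq_trans (leq_subr _ _) hj.
Qed.

(** * Polynomial functions on C^4 and vanishing ideals *)

Definition pfun (h : pt -> C) := exists f, forall v, h v = peval f v.

Lemma pfun_const (c : C) : pfun (fun=> c).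
Proof. by exists c%:MP => v; rewrite /peval mevalC. Qed.

Lemma pfun_coord i : pfun (fun v => v 0 i).
Proof. by exists 'X_i => v; rewrite /peval mevalXU. Qed.

Lemma pfunD f g : pfun f -> pfun g -> pfun (fun v => f v + g v).
Proof. by move=> [a Ha] [b Hb]; exists (a + b) => v; rewrite /peval mevalD Ha Hb. Qed.

Lemma pfunM f g : pfun f -> pfun g -> pfun (fun v => f v * g v).
Proof. by move=> [a Ha] [b Hb]; exists (a * b) => v; rewrite /peval mevalM Ha Hb. Qed.

Lemma pfun_eq f g : f =1 g -> pfun f -> pfun g.
Proof. by move=> fg [a Ha]; exists a => v; rewrite -fg. Qed.

Lemma pfun_comp f (phi : pt -> pt) : (forall i, pfun (fun v => phi v 0 i)) ->
  pfun (fun v => peval f (phi v)).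
Proof.
move=> /choice[h Hh]; exists (f \mPo [tuple h i | i < 4]) => v.
rewrite /peval comp_mpoly_meval; apply: meval_eq => i.
by rewrite tnth_mktuple Hh.
Qed.

(** Primality of the vanishing ideal without asking [T] to be closed, because products of
    projections have to be covered too. *)
Definition prime_set (T : pt -> Prop) := (exists v, T v) /\ forall f g, pfun f -> pfun g ->
  (forall v, T v -> f v * g v = 0) -> (forall v, T v -> f v = 0) \/ (forall v, T v -> g v = 0).

Lemma algset_zero (Y : pt -> Prop) f : algset Y -> pfun f -> algset (fun v => Y v /\ f v = 0).
Proof.
move=> [fs Hfs] [a Ha]; exists (a :: fs) => x; rewrite /zero_set /= -Ha.
by split=> [[/Hfs Yx /eqP ->]|/andP[/eqP ? /Hfs]].
Qed.

Lemma algset_separate (Z : pt -> Prop) (x : pt) : algset Z -> ~ Z x ->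
  exists f, (forall v, Z v -> peval f v = 0) /\ peval f x != 0.
Proof.
move=> [fs Hfs] nZx; have : has (fun f => peval f x != 0) fs.
  rewrite -[has _ _]negbK -all_predC; apply/negP => H; apply: nZx; apply/Hfs.
  by apply/allP => f /(allP H) /=; rewrite negbK.
by case/hasP => f ffs fx; exists f; split=> // v /Hfs /allP /(_ f ffs) /eqP.
Qed.

Lemma irreducible_prime_set Y : irreducible Y -> prime_set Y.
Proof.
case=> aY neY irr; split=> // f g pf pg fg.
have := irr _ _ (algset_zero aY pf) (algset_zero aY pg).
case=> [x|H|H]; last 2 first.
- by left=> v /H [].
- by right=> v /H [].
split=> [Yx|[[]//|[]//]].
have /eqP := fg _ Yx; rewrite mulf_eq0 => /orP[]/eqP; [left|right]; by [].
Qed.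

Definition pfam (R : comNzRingType) (chi : pt -> {rmorphism R -> C}) :=
  forall F, pfun (fun v => chi v F).

(** With [chi] the evaluation at selected coordinates, this is the vanishing ideal of the projection
    of [T] to them. *)
Definition van (R : comNzRingType) (chi : pt -> {rmorphism R -> C}) (T : pt -> Prop) (F : R) :=
  forall v, T v -> chi v F = 0.

Lemma pfam_id : pfam (fun=> (idfun : {rmorphism C -> C})).
Proof. exact: pfun_const. Qed.

Lemma pfam_ext (R : comNzRingType) (chi : pt -> {rmorphism R -> C}) t :
  pfam chi -> pfun t -> pfam (fun v => ext (chi v) (t v)).
Proof.
move=> pc pt F; elim/poly_ind: F => [|F c IHF].
  by apply: pfun_eq (pfun_const 0) => v; rewrite rmorph0.
apply: pfun_eq (pfunD (pfunM IHF pt) (pc c)) => v.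
by rewrite rmorphD rmorphM extX extC.
Qed.

Lemma van_prime (R : comNzRingType) (chi : pt -> {rmorphism R -> C}) T :
  prime_set T -> pfam chi -> prime_pred (van chi T).
Proof.
move=> [[v0 Tv0] pT] pc; split.
- by move=> v _; rewrite rmorph0.
- by move/(_ v0 Tv0)/eqP; rewrite rmorph1 oner_eq0.
- by move=> a b Ha Hb v Tv; rewrite rmorphD Ha ?Hb ?addr0.
- by move=> a b Hb v Tv; rewrite rmorphM Hb ?mulr0.
- move=> a b Hab; apply: pT; [exact: pc|exact: pc|] => v Tv.
  by rewrite -rmorphM Hab.
Qed.

Lemma van_extC (R : comNzRingType) (chi : pt -> {rmorphism R -> C}) t T a :
  van (fun v => ext (chi v) (t v)) T a%:P <-> van chi T a.
Proof. by split=> H v Tv; have := H v Tv; rewrite extC. Qed.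

Lemma vanS (R : comNzRingType) (chi : pt -> {rmorphism R -> C}) (T T' : pt -> Prop) a :
  subset4 T T' -> van chi T' a -> van chi T a.
Proof. by move=> s H v /s; apply: H. Qed.

(** * Evaluation of iterated polynomials *)

(* The first argument is the value of the innermost variable. *)
Definition e1 a : {rmorphism {poly C} -> C} := ext (idfun : {rmorphism C -> C}) a.
Definition e2 a b : {rmorphism {poly {poly C}} -> C} := ext (e1 a) b.
Definition e3 a b c : {rmorphism {poly {poly {poly C}}} -> C} := ext (e2 a b) c.
Definition e4 a b c d : {rmorphism {poly {poly {poly {poly C}}}} -> C} := ext (e3 a b c) d.

Definition c1 i (v : pt) := e1 (v 0 i).
Definition c2 i j (v : pt) := e2 (v 0 i) (v 0 j).
Definition c3 i j k (v : pt) := e3 (v 0 i) (v 0 j) (v 0 k).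
Definition c4 i j k l (v : pt) := e4 (v 0 i) (v 0 j) (v 0 k) (v 0 l).

Lemma pfam_c1 i : pfam (c1 i).
Proof. exact: pfam_ext pfam_id (pfun_coord i). Qed.
Lemma pfam_c2 i j : pfam (c2 i j).
Proof. exact: pfam_ext (pfam_c1 i) (pfun_coord j). Qed.
Lemma pfam_c3 i j k : pfam (c3 i j k).
Proof. exact: pfam_ext (pfam_c2 i j) (pfun_coord k). Qed.
Lemma pfam_c4 i j k l : pfam (c4 i j k l).
Proof. exact: pfam_ext (pfam_c3 i j k) (pfun_coord l). Qed.

Lemma e1E a F : e1 a F = F.[a].
Proof. by rewrite /e1 extE map_poly_id. Qed.

Lemma ext_neq0 (R : comNzRingType) (chi : {rmorphism R -> C}) F :
  chi (lead_coef F) != 0 -> exists t, ext chi t F != 0.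
Proof.
move=> l; apply/closed_nonrootP; apply: contraNneq l => E.
by have := coef_map chi F (size F).-1; rewrite E coef0 => <-.
Qed.

Lemma e1_neq0 F : F != 0 -> exists a, e1 a F != 0.
Proof. by move=> F0; apply: ext_neq0; rewrite /= lead_coef_eq0. Qed.

Lemma e2_neq0 F : F != 0 -> exists a b, e2 a b F != 0.
Proof.
move=> F0; have [|a Ha] := @e1_neq0 (lead_coef F); first by rewrite lead_coef_eq0.
by exists a; apply: ext_neq0.
Qed.

Lemma e3_neq0 F : F != 0 -> exists a b c, e3 a b c F != 0.
Proof.
move=> F0; have [|a [b Hb]] := @e2_neq0 (lead_coef F); first by rewrite lead_coef_eq0.
by exists a, b; apply: ext_neq0.
Qed.

Section Conversion.
Variables i1 i2 i3 i4 : 'I_4.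
Hypothesis u : uniq [:: i1; i2; i3; i4].

Lemma cover4 i : i \in [:: i1; i2; i3; i4].
Proof.
have sub : {subset [:: i1; i2; i3; i4] <= enum 'I_4} by move=> x _; rewrite mem_enum.
have /(uniq_min_size u sub)[_ ->] : (size (enum 'I_4) <= 4)%N by rewrite size_enum_ord.
by rewrite mem_enum.
Qed.

Definition select4 (T : Type) (a b c d : T) (i : 'I_4) :=
  if i == i1 then a else if i == i2 then b else if i == i3 then c else d.

Lemma select4E (T : Type) (a b c d : T) : [/\ select4 a b c d i1 = a,
  select4 a b c d i2 = b, select4 a b c d i3 = c & select4 a b c d i4 = d].
Proof.
move: u; rewrite /= !inE !negb_or /select4 => /and4P[/and3P[n1 n2 n3] /andP[n4 n5] n6 _].
rewrite !eqxx; split=> //.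
- by rewrite eq_sym (negPf n1).
- by rewrite eq_sym (negPf n2) eq_sym (negPf n4).
- by rewrite eq_sym (negPf n3) eq_sym (negPf n5) eq_sym (negPf n6).
Qed.

Definition iter_poly (F : {mpoly C[4]}) : {poly {poly {poly {poly C}}}} :=
  mmap (polyC \o polyC \o polyC \o polyC)
    (select4 'X%:P%:P%:P 'X%:P%:P 'X%:P 'X) F.

Lemma c4_iter_poly v F : c4 i1 i2 i3 i4 v (iter_poly F) = peval F v.
Proof.
rewrite /iter_poly /mmap rmorph_sum /peval mevalE; apply: eq_bigr => m _.
rewrite rmorphM /c4 /e4 /e3 /e2 /e1 !extC; congr (_ * _).
rewrite rmorph_prod; apply: eq_bigr => i _; rewrite rmorphXn; congr (_ ^+ _).
have [s1 s2 s3 s4] := select4E ('X%:P%:P%:P : {poly {poly {poly {poly C}}}}) 'X%:P%:P 'X%:P 'X.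
have := cover4 i; rewrite !inE => /or4P[]/eqP->.
- by rewrite s1 !extC extX.
- by rewrite s2 !extC extX.
- by rewrite s3 !extC extX.
- by rewrite s4 extX.
Qed.

Lemma algset_point Y a b c d : algset Y ->
  (forall H, van (c4 i1 i2 i3 i4) Y H -> e4 a b c d H = 0) ->
  exists2 v : pt, Y v & [/\ v 0 i1 = a, v 0 i2 = b, v 0 i3 = c & v 0 i4 = d].
Proof.
move=> [fs Hfs] kY; pose v : pt := \row_i select4 a b c d i.
have Ev : [/\ v 0 i1 = a, v 0 i2 = b, v 0 i3 = c & v 0 i4 = d].
  by have [s1 s2 s3 s4] := select4E a b c d; rewrite !mxE.
exists v => //; apply/Hfs/allP => f ffs; apply/eqP.
rewrite -c4_iter_poly /c4; case: (Ev) => -> -> -> ->; apply: kY => w /Hfs /allP /(_ f ffs) /eqP.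
by rewrite c4_iter_poly.
Qed.
End Conversion.

(** * Decomposition into irreducible sets *)

(** Choose [f n] vanishing on [S n.+1] but not on [S n]. By the basis theorem some [f n] is a
    combination of earlier ones, all of which vanish on [S n]. *)
Lemma no_infinite_descent (S : nat -> pt -> Prop) :
  (forall n, algset (S n)) -> (forall n, ssubset4 (S n.+1) (S n)) -> False.
Proof.
move=> aS dS.
have /choice[f Hf] n : exists f, (forall x, S n.+1 x -> peval f x = 0) /\
    exists x, S n x /\ peval f x != 0.
  have [_ [x [Sx nSx]]] := dS n; have [f [vf fx]] := algset_separate (aS n.+1) nSx.
  by exists f; split=> //; exists x.
have sub m n : (m <= n)%N -> subset4 (S n) (S m).
  move=> /subnK <-; elim: (n - m)%N => // k IH x.
  by rewrite addSn => /(proj1 (dS _)) /IH.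
have u : uniq [:: 0 : 'I_4; inord 1; inord 2; inord 3].
  by rewrite /= !inE -!val_eqE /= !inordK.
have noeth := hilbert_basis (hilbert_basis (hilbert_basis (hilbert_basis (@noetherian_field C)))).
have [n [c E]] := noeth (fun n => iter_poly 0 (inord 1) (inord 2) (f n)).
have [_ [x [Sx]]] := Hf n; rewrite -(c4_iter_poly u) E => /eqP; apply.
rewrite rmorph_sum big1 // => i _.
have lin : (i < n)%N by rewrite (leq_trans (ltn_ord i)) // size_mkseq.
rewrite rmorphM nth_mkseq // (c4_iter_poly u) (proj1 (Hf i)) ?mulr0 //; exact: (sub i.+1 n).
Qed.

Definition decomposable (S : pt -> Prop) := exists n (Z : nat -> pt -> Prop),
  (forall i, (i < n)%N -> irreducible (Z i)) /\
  (forall x, S x <-> exists2 i, (i < n)%N & Z i x).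

(** Noetherian induction: a set that is not decomposable is reducible, and one of its two proper
    closed parts is again not decomposable, which starts an infinite descent. *)
Lemma decomposition S : algset S -> decomposable S.
Proof.
move=> aS; apply: NNPP => nS.
have [||F [_ HF]] := @dependent_choice _ (fun S => algset S /\ ~ decomposable S)
  (fun S S' => ssubset4 S' S) S.
- by [].
- move=> X [aX nX].
  have neX : exists x, X x.
    apply: NNPP => no; apply: nX; exists 0%N, (fun=> X); split=> // x.
    by split=> [Xx|[]//]; case: no; exists x.
  have : ~ irreducible X.
    move=> iX; apply: nX; exists 1%N, (fun=> X); split=> // x.
    by split=> [Xx|[]//]; exists 0%N.
  move=> nirr; apply: NNPP => nostep; apply: nirr; split=> // A B aA aB XAB.
  apply: NNPP => /not_or_and[nA nB].
  have part A' B' : algset A' -> (forall x, X x <-> A' x \/ B' x) ->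
      ~ subset4 X A' -> decomposable A'.
    move=> aA' E nA'; apply: NNPP => ndA; apply: nostep; exists A'; split=> //.
    split; first by move=> x A'x; apply/E; left.
    apply: NNPP => no; apply: nA' => x Xx; apply: NNPP => nA'x; apply: no; by exists x.
  have [m [ZA [iA EA]]] := part A B aA XAB nA.
  have [|n [ZB [iB EB]]] := part B A aB _ nB.
    by move=> x; split=> [/XAB[]|[] ?]; [right|left|apply/XAB; right|apply/XAB; left].
  apply: nX; exists (m + n)%N, (fun i => if (i < m)%N then ZA i else ZB (i - m)%N); split.
    move=> i imn; case: ltnP => im; first exact: iA.
    by apply: iB; lia.
  move=> x; split.
    case/XAB => [/EA[i im Zi]|/EB[i im Zi]].
      by exists i; [lia|rewrite im].
    exists (m + i)%N; first by lia.
    by rewrite ltnNge leq_addr /= addKn.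
  case=> i imn; case: ltnP => im Zi; apply/XAB.
    by left; apply/EA; exists i.
  by right; apply/EB; exists (i - m)%N => //; lia.
- by apply: (@no_infinite_descent F) => n; have [[]] := HF n.
Qed.

(** * Chains of irreducible sets *)

Lemma irreducible_point (z : pt) : irreducible (fun x => x = z).
Proof.
split; last 2 first.
- by exists z.
- by move=> A B _ _ E; case: ((E z).1 erefl) => H; [left|right] => x ->.
exists [seq 'X_i - (z 0 i)%:MP | i <- enum 'I_4] => x; split=> [->|/allP H].
  by apply/allP => _ /mapP[i _ ->]; rewrite /peval mevalB mevalXU mevalC subrr.
apply/rowP => i; have := H _ (map_f _ (mem_enum 'I_4 i)).
by rewrite /peval mevalB mevalXU mevalC subr_eq0 => /eqP.
Qed.

Lemma chain_in0 Y : irreducible Y -> chain_in Y 0.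
Proof. by move=> iY; exists (fun=> Y); split=> // i _; split. Qed.

Lemma chain_inS Y Z k : irreducible Y -> ssubset4 Z Y -> chain_in Z k -> chain_in Y k.+1.
Proof.
move=> iY [sZY [y [Yy nZy]]] [W [HW dW]].
exists (fun i => if (i <= k)%N then W i else Y); split=> i ik.
  case: ifP => [/HW [? s]|_]; last by split.
  by split=> // x /s /sZY.
rewrite -ltnS ik; case: ltnP => [lt|ge]; first exact: dW.
have -> : i = k by lia.
have [_ s] := HW k (leqnn k).
split; first by move=> x /s /sZY.
by exists y; split=> // /s.
Qed.

Lemma chain_in_le Y k l : (l <= k)%N -> chain_in Y k -> chain_in Y l.
Proof.
move=> lk [W [HW dW]]; exists W; split=> i il; [apply: HW|apply: dW]; lia.
Qed.

Lemma chain_in_sub Y Z k : subset4 Y Z -> chain_in Y k -> chain_in Z k.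
Proof.
by move=> s [W [HW dW]]; exists W; split=> // i /HW [? sW]; split=> // x /sW /s.
Qed.

Lemma chain_in1_two_points Y : chain_in Y 1 -> exists p q, [/\ Y p, Y q & p <> q].
Proof.
move=> [W [HW dW]]; have [[_ [p Wp] _] sW] := HW 0%N isT.
have [s [q [Wq nWq]]] := dW 0%N isT; have [_ sW1] := HW 1%N isT.
by exists p, q; split; [exact: sW|exact: sW1|move=> E; apply: nWq; rewrite -E].
Qed.

Lemma neq_coord (p q : pt) : p <> q -> exists i, p 0 i != q 0 i.
Proof.
move=> pq; apply/existsP; apply: contra_notT pq => /existsPn H; apply/rowP => i.
by apply/eqP; have := H i; rewrite negbK.
Qed.

Lemma irreducible_chain_in1 Z p q : irreducible Z -> Z p -> Z q -> p <> q -> chain_in Z 1.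
Proof.
move=> iZ Zp Zq pq; apply: chain_inS (chain_in0 (irreducible_point p)) => //.
split; first by move=> x ->.
by exists q; split=> // E; apply: pq.
Qed.

(** * Finite sets and linear sections *)

Definition finite4 (S : pt -> Prop) := exists s : seq pt, forall x, S x -> x \in s.

Lemma finite4_card S : finite4 S -> exists n, finite_card S n.
Proof.
move=> [s Hs]; pose b x : bool := excluded_middle_informative (S x).
have bP x : reflect (S x) (b x).
  by rewrite /b; case: excluded_middle_informative => /= H; constructor.
exists (size (undup (filter b s))), (undup (filter b s)); split; rewrite ?undup_uniq // => x.
by rewrite mem_undup mem_filter; split=> [Sx|/andP[/bP] //]; rewrite (Hs x Sx) andbT; apply/bP.
Qed.

Lemma finite4_bigU n (S : nat -> pt -> Prop) : (forall i, (i < n)%N -> finite4 (S i)) ->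
  finite4 (fun x => exists2 i, (i < n)%N & S i x).
Proof.
elim: n => [|n IHn] H; first by exists [::] => x [].
have [s Hs] := IHn (fun i lt => H i (ltnW lt)); have [t Ht] := H n (ltnSn n).
exists (s ++ t) => x [m]; rewrite ltnS leq_eqVlt mem_cat => /orP[/eqP-> /Ht -> | lt Sx].
  by rewrite orbT.
by rewrite Hs //; exists m.
Qed.

Lemma finite4_sub (S T : pt -> Prop) : subset4 S T -> finite4 T -> finite4 S.
Proof. by move=> ST [s Hs]; exists s => x /ST /Hs. Qed.

(** Each component of [S] is a point: two points in one component would give a chain point,
    component, [Y] of length two. *)
Lemma finite4_proper_section Y S : irreducible Y -> ~ chain_in Y 2 ->
  algset S -> ssubset4 S Y -> finite4 S.
Proof.
move=> iY nY aS sSY; have [n [Z [iZ E]]] := decomposition aS.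
suff: finite4 (fun x => exists2 i, (i < n)%N & Z i x).
  by apply: finite4_sub => x /E.
apply: finite4_bigU => i lt; have [_ [p Zp] _] := iZ i lt.
exists [:: p] => x Zx; rewrite inE; apply/eqP; apply: NNPP => ne; apply: nY.
apply: chain_inS sSY _ => //; apply: (@chain_in_sub (Z i)); first by move=> y Zy; apply/E; exists i.
exact: irreducible_chain_in1 (iZ i lt) Zx Zp ne.
Qed.

Definition dot (l : 'rV[C]_4) (x : pt) : C := (l *m x^T) 0 0.

Lemma dot_delta i x : dot (delta_mx 0 i) x = x 0 i.
Proof. by rewrite /dot -rowE !mxE. Qed.

Lemma dotB l x y : dot l (x - y) = dot l x - dot l y.
Proof. by rewrite /dot linearB mulmxBr !mxE. Qed.

Lemma pfun_dot l : pfun (dot l).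
Proof.
exists (\sum_i (l 0 i)%:MP * 'X_i) => v.
rewrite /dot mxE /peval raddf_sum; apply: eq_bigr => i _.
by rewrite /= mevalM mevalC mevalXU mxE.
Qed.

(** Take [l] on the moment curve (1, t, t^2, t^3): its product with a nonzero [w] is a nonzero
    polynomial in [t], and finitely many such polynomials have a common nonroot. *)
Lemma dot_avoid (ws : seq pt) : (forall w, w \in ws -> w != 0) ->
  exists l, forall w, w \in ws -> dot l w != 0.
Proof.
move=> nz; have /closed_nonrootP[t] : \prod_(w <- ws) rVpoly w != 0.
  rewrite prodf_seq_neq0; apply/allP => w /nz w0 /=.
  by apply: contraNneq w0 => E; rewrite -(rVpolyK w) E linear0.
rewrite rootE horner_prod prodf_seq_neq0 => /allP H.
exists (\row_i t ^+ i) => w /H /=; apply: contraNneq => <-; rewrite /dot mxE.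
rewrite /rVpoly poly_def horner_sum; apply/eqP; apply: eq_bigr => i _.
by rewrite valK !mxE hornerZ hornerXn mulrC.
Qed.

(** The vectors [w0] and [w1] certify the rank: the pairings form a triangular matrix with nonzero
    diagonal. *)
Lemma rank_col_mx2 (l1 l2 : 'rV[C]_4) (w0 w1 : pt) :
  dot l1 w0 != 0 -> dot l1 w1 = 0 -> dot l2 w1 != 0 -> \rank (col_mx l1 l2) = 2.
Proof.
move=> h0 h1 h2; apply/eqP; rewrite eqn_leq rank_leq_row /=.
have : \rank (col_mx l1 l2 *m row_mx w0^T w1^T) = 2.
  apply: mxrank_unit; rewrite unitmxE mul_col_row.
  have -> : l1 *m w1^T = 0 by apply/matrixP => i j; rewrite !ord1 [RHS]mxE; exact: h1.
  by rewrite det_lblock !det_mx11 unitfE mulf_neq0.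
by move=> {1}<-; exact: mxrankM_maxl.
Qed.

Lemma aff_sub_col_mx2 (l1 l2 : 'rV[C]_4) (a b : C) x :
  aff_sub (col_mx l1 l2) (col_mx a%:M b%:M) x <-> dot l1 x = a /\ dot l2 x = b.
Proof.
rewrite /aff_sub mul_col_mx; split.
  by move/eq_col_mx => [E1 E2]; rewrite /dot E1 E2 !mxE eqxx !mulr1n.
by move=> [E1 E2]; congr col_mx; apply/matrixP => i j; rewrite !ord1 [RHS]mxE eqxx mulr1n.
Qed.

Lemma aff_sub1 (l : 'rV[C]_4) (a : C) x : aff_sub l (a%:M) x <-> dot l x = a.
Proof.
rewrite /aff_sub; split=> [E|E]; first by rewrite /dot E !mxE eqxx mulr1n.
by apply/matrixP => i j; rewrite !ord1 [RHS]mxE eqxx mulr1n.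
Qed.

Lemma irr_degree_bound Y k e (A : 'M[C]_(k, 4)) b (S : pt -> Prop) s :
  irr_degree Y k e -> \rank A = k -> (forall x, S x <-> Y x /\ aff_sub A b x) ->
  finite4 S -> uniq s -> (forall x, x \in s -> S x) -> (size s <= e)%N.
Proof.
move=> [_ He] rA ES fS us Ss.
have [|n Hn] := @finite4_card (fun x => Y x /\ aff_sub A b x).
  by apply: finite4_sub fS => x /ES.
apply: leq_trans (He A b n rA Hn); have [t [ut <- Ht]] := Hn.
by apply: uniq_leq_size => // x /Ss /ES /Ht.
Qed.

Lemma irr_degree2_coord Y e i j a b s : irr_degree Y 2 e -> i != j ->
  finite4 (fun x => Y x /\ (x 0 i = a /\ x 0 j = b)) -> uniq s ->
  (forall x, x \in s -> Y x /\ (x 0 i = a /\ x 0 j = b)) -> (size s <= e)%N.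
Proof.
move=> de ij; apply: (irr_degree_bound (A := col_mx (delta_mx 0 i) (delta_mx 0 j))
  (b := col_mx a%:M b%:M) de).
  apply: (@rank_col_mx2 _ _ (delta_mx 0 i) (delta_mx 0 j)); rewrite dot_delta mxE !eqxx ?oner_eq0 //=.
  by rewrite (negPf ij).
by move=> x; rewrite aff_sub_col_mx2 !dot_delta.
Qed.

(** It suffices to find, through some point of [Y], a linear section of complementary dimension that
    is finite. This is what bounds the number of components by the degree. *)
Lemma irr_degree_gt0 Y k e : irreducible Y -> has_dim Y k -> irr_degree Y k e ->
  (k <= 2)%N -> (0 < e)%N.
Proof.
move=> iY [cY nY] de k2; have [aY [p0 Yp0] _] := iY.
case: k k2 cY nY de => [_ _ nY de|[_ cY nY de|[_ cY nY de|//]]].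
- apply: (irr_degree_bound (A := 0) (b := 0) (S := Y) (s := [:: p0]) de) => //.
  + by rewrite mxrank0.
  + by move=> x; split=> [Yx|[]//]; split=> //; apply/matrixP => -[].
  + exists [:: p0] => x Yx; rewrite inE; apply/eqP; apply: NNPP => ne; apply: nY.
    exact: irreducible_chain_in1 iY Yx Yp0 ne.
  + by move=> x; rewrite inE => /eqP->.
- have [p [q [Yp Yq pq]]] := chain_in1_two_points cY.
  have [i Hi] := neq_coord pq.
  pose S x := Y x /\ x 0 i - p 0 i = 0.
  apply: (irr_degree_bound (A := delta_mx 0 i) (b := (p 0 i)%:M) (S := S) (s := [:: p]) de) => //.
  + by rewrite mxrank_delta.
  + move=> x; split=> [] [Yx]; first by move/subr0_eq => E; split=> //; apply/aff_sub1; rewrite dot_delta.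
    by move/aff_sub1; rewrite dot_delta => E; split=> //; rewrite E subrr.
  + apply: (@finite4_proper_section Y) => //.
      apply: algset_zero => //; apply: pfunD (pfun_coord i) (pfun_const _).
    split; first by move=> x [].
    by exists q; split=> // -[_ /subr0_eq E]; rewrite E eqxx in Hi.
  + by move=> x; rewrite inE => /eqP->; split; rewrite ?subrr.
- have [p [q [Yp Yq pq]]] := chain_in1_two_points (chain_in_le (isT : (1 <= 2)%N) cY).
  have [i Hi] := neq_coord pq.
  have [j ji] : exists j : 'I_4, j != i.
    by case: (eqVneq i ord0) => [->|]; [exists ord_max | rewrite eq_sym => ?; exists ord0].
  pose S x := Y x /\ x 0 i - p 0 i = 0.
  have aS : algset S by apply: algset_zero => //; apply: pfunD (pfun_coord i) (pfun_const _).
  have sS : ssubset4 S Y.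
    split; first by move=> x [].
    by exists q; split=> // -[_ /subr0_eq E]; rewrite E eqxx in Hi.
  have [n [Z [iZ EZ]]] := decomposition aS.
  (* Each component of the hyperplane section that is not just [p] gets a point [z m] other than
     [p], which the second hyperplane through [p] must miss. *)
  have /choice[z Hz] m : exists z : pt, z != p /\ ((m < n)%N -> Z m z \/ forall x, Z m x -> x = p).
    case: (classic (exists z, Z m z /\ z <> p)) => [[z [Zz /eqP zp]]|no].
      by exists z; split=> // _; left.
    exists q; split; first by apply/eqP => E; apply: pq.
    by move=> _; right=> x Zx; apply: NNPP => ne; apply: no; exists x.
  (* Including [delta_mx 0 j] among the vectors to avoid keeps [l] linearly independent of the
     coordinate form [i]. *)
  have [|l Hl] := @dot_avoid (delta_mx 0 j :: [seq z m - p | m <- iota 0 n]).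
    move=> w; rewrite inE => /orP[/eqP->|/mapP[m _ ->]]; last by rewrite subr_eq0; case: (Hz m).
    by apply/eqP => /rowP /(_ j); rewrite !mxE !eqxx => /eqP; rewrite oner_eq0.
  pose S2 x := S x /\ dot l x - dot l p = 0.
  apply: (irr_degree_bound (A := col_mx (delta_mx 0 i) l) (b := col_mx (p 0 i)%:M (dot l p)%:M)
    (S := S2) (s := [:: p]) de) => //.
  + apply: (@rank_col_mx2 _ _ (delta_mx 0 i) (delta_mx 0 j)).
    * by rewrite dot_delta mxE !eqxx oner_eq0.
    * by rewrite dot_delta mxE eqxx eq_sym (negPf ji).
    * by apply: Hl; rewrite mem_head.
  + move=> x; rewrite aff_sub_col_mx2 dot_delta /S2 /S.
    split=> [[[Yx /subr0_eq-> /subr0_eq->]]|[Yx [-> ->]]] //.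
    by rewrite !subrr.
  + suff: finite4 (fun x => exists2 m, (m < n)%N & Z m x /\ dot l x - dot l p = 0).
      by apply: finite4_sub => x [/EZ [m lt Zx] E]; exists m.
    apply: finite4_bigU => m lt; have [zp /(_ lt) Hzm] := Hz m.
    case: Hzm => [Zz|single]; last by exists [:: p] => x [/single-> _]; rewrite inE.
    have iZm := iZ m lt; have [aZ _ _] := iZm.
    apply: (@finite4_proper_section (Z m)) => //.
    * move=> c2; apply: nY; apply: chain_inS sS _ => //.
      by apply: chain_in_sub c2 => x Zx; apply/EZ; exists m.
    * by apply: algset_zero => //; apply: pfunD (pfun_dot l) (pfun_const _).
    * split; first by move=> x [].
      exists (z m); split=> // -[_]; rewrite -dotB; apply/eqP; apply: Hl.
      by rewrite inE; apply/orP; right; apply/mapP; exists m => //; rewrite mem_iota.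
  + by move=> x; rewrite inE => /eqP->; rewrite /S2 /S !subrr.
Qed.

(** * Algebraically independent coordinates *)

Section ExtMaps.
Variables (R K : comNzRingType) (chi : {rmorphism R -> K}).

Lemma ext_horner (D : {poly R}) t : chi D.[t] = ext chi (chi t) D.
Proof. by rewrite extE horner_map. Qed.

Lemma ext_map_polyC b c (B : {poly R}) : ext (ext chi b) c (map_poly polyC B) = ext chi c B.
Proof.
rewrite !extE -map_poly_comp; congr (_.[_]); apply: eq_map_poly => a /=.
exact: extC.
Qed.

Lemma ext_swapXY b c (F : {poly {poly R}}) :
  ext (ext chi b) c F = ext (ext chi c) b (swapXY F).
Proof.
elim/poly_ind: F => [|F p IHF]; first by rewrite !raddf0.
have -> : swapXY (F * 'X + p%:P) = swapXY F * 'X%:P + map_poly polyC p.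
  by rewrite rmorphD rmorphM /= swapXY_X swapXY_polyC.
by rewrite [LHS]rmorphD [RHS]rmorphD !rmorphM ext_map_polyC !extC !extX IHF.
Qed.
End ExtMaps.

Definition indep2 Y i j := forall F, van (c2 i j) Y F -> F = 0.
Definition indep3 Y i j k := forall F, van (c3 i j k) Y F -> F = 0.

Lemma indep2C Y i j : indep2 Y i j -> indep2 Y j i.
Proof.
move=> ind F vF; apply/eqP; rewrite -swapXY_eq0; apply/eqP; apply: ind => v Yv.
by rewrite /c2 /e2 /e1 -ext_swapXY; exact: vF.
Qed.

(** Otherwise some nonzero [G i] vanishes on each component, and their product, nonzero in a domain,
    vanishes on all of [S]. *)
Lemma component_indep (R : idomainType) (chi : pt -> {rmorphism R -> C}) (S : pt -> Prop) :
  algset S -> (forall G, G != 0 -> exists2 v, S v & chi v G != 0) ->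
  exists Z, [/\ irreducible Z, subset4 Z S & forall G, van chi Z G -> G = 0].
Proof.
move=> aS HS; have [n [Z [iZ E]]] := decomposition aS; apply: NNPP => no.
have /choice[G HG] i : exists G, G != 0 /\ ((i < n)%N -> van chi (Z i) G).
  have [lt|ge] := ltnP i n; last by exists 1; rewrite oner_eq0.
  apply: NNPP => noG; apply: no; exists (Z i); split; first exact: iZ.
    by move=> x Zx; apply/E; exists i.
  by move=> G vG; apply/eqP/negPn/negP => G0; apply: noG; exists G.
have [|v /E [i lt Zv]] := HS (\prod_(i < n) G i).
  by apply/prodf_neq0 => i _; case: (HG i).
rewrite rmorph_prod (bigD1 (Ordinal lt)) //= (proj2 (HG i) lt v Zv) mul0r.
by rewrite eqxx.
Qed.

Section Lifting.
Variables (Y : pt -> Prop) (i1 i2 i3 i4 : 'I_4).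
Hypotheses (iY : irreducible Y) (u : uniq [:: i1; i2; i3; i4]).
Let pY := irreducible_prime_set iY.

(** [extend_point] with [g = 1]: generic zeros of the ideal of the projection are projections of
    points of [Y], because [Y] is closed. *)
Lemma lift3 : exists D, ~ van (c3 i1 i2 i3) Y D /\ forall a b c,
  (forall H, van (c3 i1 i2 i3) Y H -> e3 a b c H = 0) -> e3 a b c D != 0 ->
  exists2 v : pt, Y v & [/\ v 0 i1 = a, v 0 i2 = b & v 0 i3 = c].
Proof.
have P4 := van_prime pY (pfam_c4 i1 i2 i3 i4).
have [D [nD HD]] :=
  @extend_point {poly {poly {poly C}}} (van (c4 i1 i2 i3 i4) Y) C P4 1 (prime_pred1 P4).
exists D; split=> [vD|a b c kY Dabc]; first by apply/nD/van_extC.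
have [||d [kd _]] := HD (e3 a b c) => //; first by move=> H /van_extC; exact: kY.
have [aY _ _] := iY; have [v Yv [? ? ? _]] := algset_point u aY kd.
by exists v.
Qed.

Lemma lift2 : exists D, ~ van (c2 i1 i2) Y D /\ forall a b,
  (forall H, van (c2 i1 i2) Y H -> e2 a b H = 0) -> e2 a b D != 0 ->
  exists2 v : pt, Y v & v 0 i1 = a /\ v 0 i2 = b.
Proof.
have [D3 [nD3 HD3]] := lift3.
have [D [nD HD]] := extend_point C (van_prime pY (pfam_c3 i1 i2 i3)) nD3.
exists D; split=> [vD|a b kY Dab]; first by apply/nD/van_extC.
have [||c [kc Dc]] := HD (e2 a b) => //; first by move=> H /van_extC; exact: kY.
by have [v Yv [? ? ?]] := HD3 a b c kc Dc; exists v.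
Qed.

(* A hyperplane [x_i3 = c] meets the dense part of [Y] over which points lift. *)
Lemma slice3 : indep3 Y i1 i2 i3 -> exists Z, [/\ irreducible Z, ssubset4 Z Y & indep2 Z i1 i2].
Proof.
move=> ind; have [D [nD HD]] := lift3; have [aY _ _] := iY.
have D0 : D != 0 by apply/eqP => D0; apply: nD => v _; rewrite D0 rmorph0.
have [a0 [b0 [c Dc]]] := e3_neq0 D0.
have Ec a b : e3 a b c D = e2 a b D.[c%:P%:P].
  by rewrite ext_horner /e2 /e1 !extC.
have [|G G0|Z [iZ sZ iZ2]] := @component_indep _ (c2 i1 i2) (fun v => Y v /\ v 0 i3 - c = 0).
- by apply: algset_zero => //; apply: pfunD (pfun_coord i3) (pfun_const _).
- have : G * D.[c%:P%:P] != 0.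
    by rewrite mulf_neq0 //; apply: contraNneq Dc => E; rewrite Ec E rmorph0.
  move/e2_neq0 => [a [b]]; rewrite rmorphM mulf_eq0 negb_or -Ec => /andP[Gab Dabc].
  have [|v Yv [va vb vc]] := HD a b c _ Dabc; first by move=> H /ind ->; rewrite rmorph0.
  by exists v; [rewrite vc subrr | rewrite /c2 va vb].
exists Z; split=> //; split; first by move=> x /sZ [].
apply: NNPP => no.
have /ind /eqP : van (c3 i1 i2 i3) Y ('X - c%:P%:P%:P).
  move=> v Yv; have [_ vc] : Y v /\ v 0 i3 - c = 0.
    by apply: sZ; apply: NNPP => nZ; apply: no; exists v.
  by rewrite rmorphB /c3 /e3 /e2 /e1 extX !extC.
by rewrite polyXsubC_eq0.
Qed.

Lemma slice2 : indep2 Y i1 i2 -> exists Z, [/\ irreducible Z, ssubset4 Z Y &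
  forall F, van (c1 i1) Z F -> F = 0].
Proof.
move=> ind; have [D [nD HD]] := lift2; have [aY _ _] := iY.
have D0 : D != 0 by apply/eqP => D0; apply: nD => v _; rewrite D0 rmorph0.
have [a0 [b Db]] := e2_neq0 D0.
have Eb a : e2 a b D = e1 a D.[b%:P] by rewrite ext_horner /e1 extC.
have [|G G0|Z [iZ sZ iZ2]] := @component_indep _ (c1 i1) (fun v => Y v /\ v 0 i2 - b = 0).
- by apply: algset_zero => //; apply: pfunD (pfun_coord i2) (pfun_const _).
- have : G * D.[b%:P] != 0.
    by rewrite mulf_neq0 //; apply: contraNneq Db => E; rewrite Eb E rmorph0.
  move/e1_neq0 => [a]; rewrite rmorphM mulf_eq0 negb_or -Eb => /andP[Ga Dab].
  have [|v Yv [va vb]] := HD a b _ Dab; first by move=> H /ind ->; rewrite rmorph0.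
  by exists v; [rewrite vb subrr | rewrite /c1 va].
exists Z; split=> //; split; first by move=> x /sZ [].
apply: NNPP => no.
have /ind /eqP : van (c2 i1 i2) Y ('X - b%:P%:P).
  move=> v Yv; have [_ vb] : Y v /\ v 0 i2 - b = 0.
    by apply: sZ; apply: NNPP => nZ; apply: no; exists v.
  by rewrite rmorphB /c2 /e2 /e1 extX !extC.
by rewrite polyXsubC_eq0.
Qed.
End Lifting.

(** Each slice is strictly smaller and loses one independent coordinate; a set on which one
    coordinate is still transcendental has two points. *)
Lemma indep3_chain Y i1 i2 i3 i4 : irreducible Y -> uniq [:: i1; i2; i3; i4] ->
  indep3 Y i1 i2 i3 -> chain_in Y 3.
Proof.
move=> iY u /(slice3 iY u) [Z2 [iZ2 sZ2 /(slice2 iZ2 u) [Z1 [iZ1 sZ1 ind]]]].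
apply: chain_inS sZ2 _ => //; apply: chain_inS sZ1 _ => //.
have [_ [p Zp] _] := iZ1.
have [q Zq pq] : exists2 q, Z1 q & p <> q.
  apply: NNPP => no; have /ind /eqP : van (c1 i1) Z1 ('X - (p 0 i1)%:P).
    move=> v Zv; have <- : p = v by apply: NNPP => ne; apply: no; exists v.
    by rewrite /c1 e1E hornerXsubC subrr.
  by rewrite polyXsubC_eq0.
exact: irreducible_chain_in1 iZ1 Zp Zq pq.
Qed.

Definition finvals (S : pt -> Prop) i := exists s : seq C, forall x : pt, S x -> x 0 i \in s.

Lemma finvals_finite4 S : (forall i, finvals S i) -> finite4 S.
Proof.
move=> /choice[s Hs].
pose step (i : 'I_4) (fs : seq {ffun 'I_4 -> C}) : seq {ffun 'I_4 -> C} :=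
  [seq [ffun j : 'I_4 => if j == i then c else (f : {ffun 'I_4 -> C}) j] | c <- s i, f <- fs].
exists [seq (\row_i f i : pt) | f : {ffun 'I_4 -> C} <- foldr step [:: [ffun=> 0]] (enum 'I_4)].
move=> x Sx; have -> : x = \row_i [ffun i => x 0 i] i by apply/rowP => i; rewrite !mxE ffunE.
apply: (map_f (fun f : {ffun 'I_4 -> C} => (\row_i f i : pt))).
have gen t : [ffun i => if i \in t then x 0 i else 0] \in foldr step [:: [ffun=> 0]] t.
  elim: t => [|i t IHt] /=.
    by rewrite inE; apply/eqP/ffunP => i; rewrite !ffunE.
  apply/allpairsP; exists (x 0 i, [ffun i => if i \in t then x 0 i else 0]); split=> //=.
    exact: Hs.
  by apply/ffunP => j; rewrite !ffunE inE; case: eqP => [->|].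
have <- : [ffun i => if i \in enum 'I_4 then x 0 i else 0] = [ffun i => x 0 i].
  by apply/ffunP => i; rewrite !ffunE mem_enum.
exact: gen.
Qed.

Lemma poly_roots_seq (p : {poly C}) : p != 0 -> exists s : seq C, forall x, p.[x] = 0 -> x \in s.
Proof.
move=> p0; have [s Es] := closed_field_poly_normal p; exists s => x px.
rewrite -root_prod_XsubC -(@rootZ _ _ (lead_coef p)) ?lead_coef_eq0 // -Es.
by apply/rootP.
Qed.

Lemma van_c1_finvals (S : pt -> Prop) i F : F != 0 -> van (c1 i) S F -> finvals S i.
Proof.
move=> /poly_roots_seq[s Hs] vF; exists s => x Sx; apply: Hs.
by rewrite -e1E; exact: vF.
Qed.

(** * Degrees of minimal relations *)

(* Over a generic point [(a, b)] all the roots of [A] are simple and lift to [Y], so the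
   section of [Y] by two coordinate hyperplanes has at least [(size A).-1] points. *)
Lemma min_degree_le Y e i1 i2 i3 i4 A : irreducible Y -> uniq [:: i1; i2; i3; i4] ->
  irr_degree Y 2 e -> indep2 Y i1 i2 -> ~ indep3 Y i1 i2 i4 ->
  van (c3 i1 i2 i3) Y A -> A != 0 ->
  (forall H, van (c3 i1 i2 i3) Y H -> H != 0 -> (size A <= size H)%N) ->
  (size A <= e.+1)%N.
Proof.
move=> iY u de ind nind vA A0 minA; have pY := irreducible_prime_set iY.
have P4 := van_prime pY (pfam_c4 i1 i2 i3 i4).
have P3 := van_prime pY (pfam_c3 i1 i2 i3).
have nvan2 F : F != 0 -> ~ van (c2 i1 i2) Y F by move=> F0 /ind E; rewrite E eqxx in F0.
have mA : min_relation (van (c3 i1 i2 i3) Y) A.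
  split=> //; first by move=> /van_extC; apply: nvan2; rewrite lead_coef_eq0.
  move=> H vH lH; apply: minA => //; apply/eqP => H0; apply: lH.
  by rewrite H0 lead_coef0; exact: (prime_pred0 P3).
have sA := min_relation_size mA.
have [F4 mF4] : exists F, min_relation (van (c4 i1 i2 i3 i4) Y) F.
  have [B nB] := not_all_ex_not _ _ nind.
  have [vB /eqP B0] := imply_to_and _ _ nB.
  apply: (@min_relation_exists _ _ (map_poly polyC B)).
    by move=> v Yv; rewrite /c4 /e4 /e3 ext_map_polyC; exact: vB.
  rewrite lead_coef_map_inj //; last exact: polyC_inj.
  by move=> /van_extC /van_extC; apply: nvan2; rewrite lead_coef_eq0.
have [vF4 lF4 _] := mF4.
have nlF4 : ~ van (c3 i1 i2 i3) Y (lead_coef F4) by move=> v; apply/lF4/van_extC.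
(* In characteristic zero the derivative is nonzero, and in the ideal it would be a shorter relation
   than [A]. *)
have nA' : ~ van (c3 i1 i2 i3) Y A^`().
  move=> vA'; have : A^`() != 0.
    apply/eqP => /(congr1 (fun p : {poly _} => p`_(size A).-2)); rewrite coef_deriv coef0.
    have -> : ((size A).-2.+1 = (size A).-1)%N by rewrite prednK // -subn1 subn_gt0.
    move/eqP; rewrite -lead_coefE -mulr_natr mulf_eq0 lead_coef_eq0 (negPf A0) /=.
    rewrite -!polyC_natr !polyC_eq0 Num.Theory.pnatr_eq0.
    by rewrite -subn1 subn_eq0 leqNgt sA.
  by move/(minA _ vA'); rewrite leqNgt lt_size_deriv.
have [w [r [nr vr]]] := relation_unit P3 vA (let: And3 _ l _ := mA in l) (prime_predMn P3 nA' nlF4).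
have r0 : r != 0 by apply/eqP => r0; apply: nr; rewrite r0; exact: (prime_pred0 P3).
have [|a [b]] := @e2_neq0 (r * lead_coef A); first by rewrite mulf_neq0 ?lead_coef_eq0.
rewrite rmorphM mulf_eq0 negb_or => /andP[rab lab].
pose p := map_poly (e2 a b) A.
have sp : size p = size A by rewrite size_map_poly_id0.
have p0 : p != 0 by rewrite -size_poly_gt0 sp ltnW.
have k2 F : van (c3 i1 i2 i3) Y F%:P -> e2 a b F = 0 by move=> /van_extC /ind ->; rewrite rmorph0.
have roots c : p.[c] = 0 -> [/\ forall H, van (c3 i1 i2 i3) Y H -> e3 a b c H = 0,
   e3 a b c A^`() != 0 & e3 a b c (lead_coef F4) != 0].
  move=> pc; have kc := min_relation_root P3 mA k2 lab pc; split=> //;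
  have /eqP := kc _ vr; rewrite rmorphB extC !rmorphM subr_eq0 => /eqP E;
  by apply: contraNneq rab => E0; rewrite E E0 ?mulr0 ?mul0r ?mulr0.
have [z Ez] := closed_field_poly_normal p.
have mem_z c : c \in z -> p.[c] = 0.
  by move=> cz; apply/eqP; rewrite Ez hornerZ mulf_eq0; apply/orP; right; rewrite -rootE root_prod_XsubC.
have z_mem c : p.[c] = 0 -> c \in z.
  move=> pc; rewrite -root_prod_XsubC -(@rootZ _ _ (lead_coef p)) ?lead_coef_eq0 // -Ez.
  by apply/rootP.
have uz : uniq z.
  rewrite -separable_prod_XsubC -(@eqp_separable _ p); last first.
    by rewrite Ez eqp_scale // lead_coef_eq0.
  rewrite unlock; apply: Pdiv.ClosedField.root_coprimep => c /rootP /roots [_ + _].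
  by rewrite /e3 extE deriv_map.
have sz : size A = (size z).+1.
  by rewrite -sp Ez size_scale ?lead_coef_eq0 // size_prod_XsubC.
rewrite sz ltnS.
have /choice[pnt Hp] c : exists v : pt, p.[c] = 0 -> Y v /\ [/\ v 0 i1 = a, v 0 i2 = b & v 0 i3 = c].
  case: (classic (p.[c] = 0)) => [pc|]; last by exists 0.
  have [kc _ lc] := roots c pc.
  have sF4 := min_relation_size mF4.
  have : size (map_poly (e3 a b c) F4) != 1.
    by rewrite size_map_poly_id0 // gtn_eqF.
  move/closed_rootP => [d /rootP rd].
  have k3 F : van (c4 i1 i2 i3 i4) Y F%:P -> e3 a b c F = 0 by move=> /van_extC; exact: kc.
  have kd := min_relation_root P4 mF4 k3 lc rd.
  have [aY _ _] := iY; have [v Yv [? ? ? _]] := algset_point u aY kd.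
  by exists v.
rewrite -(size_map pnt); apply: (@irr_degree2_coord Y e i1 i2 a b).
- by [].
- by move: u; rewrite /= inE negb_or => /andP[/andP[]].
(* [irr_degree] bounds finite sections only, so the whole fibre over [(a, b)] has to be shown
   finite. *)
- apply: finvals_finite4 => i; have := cover4 u i; rewrite !inE => /or4P[]/eqP->.
  + by exists [:: a] => x [_ [-> _]]; rewrite inE.
  + by exists [:: b] => x [_ [_ ->]]; rewrite inE.
  + exists z => x [Yx [xa xb]]; apply: z_mem.
    by have := vA x Yx; rewrite /c3 xa xb.
  + have /choice[rts Hr] c : exists s : seq C, p.[c] = 0 ->
        forall d, (map_poly (e3 a b c) F4).[d] = 0 -> d \in s.
      case: (classic (p.[c] = 0)) => [/roots [_ _ lc]|]; last by exists [::].
      have : map_poly (e3 a b c) F4 != 0.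
        rewrite -size_poly_gt0 size_map_poly_id0 //; exact: ltnW (min_relation_size mF4).
      by move/poly_roots_seq => [s Hs]; exists s.
    exists (flatten (map rts z)) => x [Yx [xa xb]].
    have px : p.[x 0 i3] = 0 by have := vA x Yx; rewrite /c3 xa xb.
    apply/flattenP; exists (rts (x 0 i3)); first by apply: map_f; apply: z_mem.
    by apply: Hr => //; have := vF4 x Yx; rewrite /c4 xa xb.
- rewrite map_inj_in_uniq // => c c' /mem_z /Hp [_ [_ _ E]] /mem_z /Hp [_ [_ _ E']] EE.
  by rewrite -E -E' EE.
- by move=> x /mapP[c /mem_z /Hp [Yc [? ? _]] ->].
Qed.

(** * Contracted curves *)

Lemma size_det_le (D : idomainType) n (M : 'M[{poly D}]_n) k :
  (forall i j, (size (M i j) <= k.+1)%N) -> (size (\det M) <= (n * k).+1)%N.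
Proof.
move=> sM; apply: (leq_trans (size_sum _ _ _)); apply/bigmax_leqP => s _.
rewrite mulr_sign.
rewrite (fun_if (fun p : {poly D} => size p)) size_polyN if_same.
apply: (leq_trans (size_prod_leq _ _)).
have : (\sum_(i < n) size (M i (s i)) <= n * k.+1)%N.
  rewrite -[n in (n * _)%N]card_ord -sum_nat_const; apply: leq_sum => i _; exact: sM.
by rewrite card_ord mulnS => H; rewrite leq_subLR addnS ltnS.
Qed.

(** The Sylvester matrix has at most 2m rows, and its entries have degree at most [k] in the inner
    variable. *)
Lemma size_resultant_le (D : idomainType) (A B : {poly {poly D}}) m k :
  (size A <= m.+1)%N -> (size B <= m.+1)%N -> (sizeY A <= k.+1)%N -> (sizeY B <= k.+1)%N ->
  (size (resultant A B) <= (2 * m * k).+1)%N.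
Proof.
move=> sA sB yA yB; apply: (@leq_trans (((size B).-1 + (size A).-1) * k).+1); last first.
  by rewrite ltnS leq_mul2r; apply/orP; right; lia.
apply: size_det_le => i j; rewrite Sylvester_mxE.
case: split => l; case: (leqP l j) => _ /=; rewrite ?mulr1n ?mulr0n ?size_poly0 //.
- exact: leq_trans (max_size_coefXY _ _) yA.
- exact: leq_trans (max_size_coefXY _ _) yB.
Qed.

Lemma fiberwise_size (T U : eqType) (L : seq (T * U)) (s : seq T) k :
  (forall p, p \in L -> p.1 \in s) ->
  (forall a, (size [seq p <- L | p.1 == a] <= k)%N) -> (size L <= size s * k)%N.
Proof.
elim: s L => [|a s IHs] L Ls Lk.
  by case: L Ls {Lk} => // p L /(_ p (mem_head _ _)).
rewrite -(count_predC (fun p => p.1 == a)) -!size_filter /= mulSn leq_add //.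
apply: IHs => [p|b].
  by rewrite mem_filter /= => /andP[ne /Ls]; rewrite inE (negPf ne).
apply: leq_trans (Lk b); rewrite -filter_predI !size_filter; apply: sub_count => p /andP[]//.
Qed.

Lemma factor_inner (D : idomainType) (A : {poly {poly D}}) (x : D) :
  map_poly (horner_eval x) A = 0 -> exists A1, A = ('X - x%:P)%:P * A1.
Proof.
move=> E; have /factor_theorem[q Eq] : root (swapXY A) x%:P.
  by rewrite rootE horner_swapXY; apply/eqP.
exists (swapXY q); rewrite -[A]swapXYK Eq rmorphM /= rmorphB /= swapXY_X.
by rewrite !swapXY_polyC map_polyC /= polyCB mulrC.
Qed.

Lemma e3_horner a c d (F : {poly {poly {poly C}}}) : e1 a F.[d%:P%:P].[c%:P] = e3 a c d F.
Proof. by rewrite !ext_horner /e1 !extC. Qed.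

Definition fib Y (i j : 'I_4) (p : C * C) (v : pt) := Y v /\ (v 0 i = p.1 /\ v 0 j = p.2).

(** A shortest relation between s and x holds at x = [p.1] for infinitely many s, so it is divisible
    by x - [p.1]; as x is not constantly [p.1], the quotient is a shorter relation. *)
Lemma contracted_indep Y (s x y : 'I_4) p : irreducible Y -> ~ van (c1 x) Y ('X - (p.1)%:P) ->
  ~ finvals (fib Y x y p) s -> indep2 Y s x.
Proof.
move=> iY nx nfin F0 vF0; apply/eqP/negPn/negP => F00.
have P2 := van_prime (irreducible_prime_set iY) (pfam_c2 s x).
have [|F [[vF Fn0] minF]] := @exists_minimal _ (fun F => van (c2 s x) Y F /\ F != 0) (fun F => size F).
  by exists F0.
have /factor_theorem[q Eq] : root F (p.1)%:P.
  apply/rootP; apply/eqP/negPn/negP => n0; apply: nfin.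
  apply: (van_c1_finvals n0) => v [Yv [vx vy]].
  by rewrite /c1 ext_horner /e1 extC /=; have := vF v Yv; rewrite /c2 vx.
have q0 : q != 0 by apply: contraNneq Fn0 => q0; rewrite Eq q0 mul0r.
have : van (c2 s x) Y q.
  have := vF; rewrite Eq => /(prime_pred_prime P2) [//|vx]; exfalso; apply: nx => v Yv.
  have := vx v Yv; rewrite /c2 /c1 /e2 /e1 !rmorphB !extX !extC.
  by rewrite /= => E.
move=> vq; have := minF q (conj vq q0); rewrite Eq size_mul ?polyXsubC_eq0 // size_XsubC.
by rewrite addn2 /= ltnn.
Qed.

Section Contracted.
Variables (Y : pt -> Prop) (e : nat) (s x y t : 'I_4).
Hypotheses (iY : irreducible Y) (u : uniq [:: s; x; y; t]) (de : irr_degree Y 2 e).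
Hypotheses (nY : ~ chain_in Y 3) (ind : indep2 Y x y).

Let pY := irreducible_prime_set iY.

Lemma dep3 i j k l : uniq [:: i; j; k; l] -> ~ indep3 Y i j k.
Proof. by move=> ul /(indep3_chain iY ul). Qed.

Lemma indep2_nonconstant i j c : indep2 Y i j -> ~ van (c1 i) Y ('X - c%:P).
Proof.
move=> indij vc; have /indij/eqP : van (c2 i j) Y ('X - c%:P)%:P by apply/van_extC.
by rewrite polyC_eq0 polyXsubC_eq0.
Qed.

Section BothIndep.
Hypotheses (isx : indep2 Y s x) (isy : indep2 Y s y).

Let P := van (c3 s x y) Y.
Let Pp : prime_pred P. Proof. exact: van_prime pY (pfam_c3 s x y). Qed.
Let P0 F : P F%:P -> F = 0. Proof. by move=> /van_extC /isx. Qed.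

(** [A] has least degree in y and, among such relations, least degree in x. Sections bound the
    former directly. For the latter they bound a relation of least degree in x; by Gauss's lemma [A]
    divides it up to a factor depending on s alone, so its degree in x is no larger. *)
Lemma lexmin_relation : exists A, [/\ P A, A != 0, (size A <= e.+1)%N, (sizeY A <= e.+1)%N &
  (forall F, P F -> F != 0 -> (size A <= size F)%N) /\
  (forall F, P F -> F != 0 -> size F = size A -> (sizeY A <= sizeY F)%N)].
Proof.
have exi i j k l : uniq [:: i; j; k; l] -> exists F, van (c3 i j k) Y F /\ F != 0.
  move=> /dep3 /not_all_ex_not[B nB]; have [vB /eqP B0] := imply_to_and _ _ nB.
  by exists B.
have [A1 [[PA1 A10] minA1]] := exists_minimal (fun F : {poly {poly {poly C}}} => size F) (exi _ _ _ _ u).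
have [|A [[PA A0 sA] minYA]] := @exists_minimal _
   (fun F => [/\ P F, F != 0 & size F = size A1]) (@sizeY _).
  by exists A1.
have minA F : P F -> F != 0 -> (size A <= size F)%N by move=> PF F0; rewrite sA; apply: minA1.
have {}minYA F : P F -> F != 0 -> size F = size A -> (sizeY A <= sizeY F)%N.
  by move=> PF F0 sF; apply: minYA; rewrite -sA.
have u1 : uniq [:: s; x; t; y].
  by move: u; rewrite /= !inE !negb_or => /and4P[/and3P[-> -> ->] /andP[-> ->]] /=; rewrite eq_sym => ->.
have u2 : uniq [:: s; y; x; t].
  by move: u; rewrite /= !inE !negb_or => /and4P[/and3P[-> -> ->] /andP[+ ->] ->] /=; rewrite eq_sym => ->.
have u3 : uniq [:: s; y; t; x].
  by move: u; rewrite /= !inE !negb_or ![y == _]eq_sym ![t == _]eq_sym => /and4P[/and3P[-> -> ->] /andP[-> ->] ->].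
exists A; split=> //; first exact: (min_degree_le iY u de isx (dep3 u1) PA A0).
have [F [[vF F0] minF]] := exists_minimal (fun F : {poly {poly {poly C}}} => size F) (exi _ _ _ _ u2).
have sF : (size F <= e.+1)%N.
  by apply: (min_degree_le iY u2 de isy (dep3 u3) vF F0) => H vH H0; apply: minF.
have PF : P (swapXY F) by move=> v Yv; rewrite /c3 /e3 /e2 -ext_swapXY; exact: vF.
have F'0 : swapXY F != 0 by rewrite swapXY_eq0.
have [c [Q [c0 E]]] := gauss_divides Pp P0 PA A0 minA minYA PF.
have Q0 : Q != 0.
  apply: contraNneq F'0 => Q0; move: E; rewrite Q0 mul0r => /eqP.
  by rewrite mulf_eq0 !polyC_eq0 (negPf c0).
have := congr1 (@sizeY _) E; rewrite !sizeYM ?polyC_eq0 // sizeYC size_polyC c0 add1n /=.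
rewrite sizeYE swapXYK => sE; apply: leq_trans sF; rewrite sE.
have : (0 < sizeY Q)%N by rewrite lt0n sizeY_eq0.
by case: (sizeY Q) => // n _; rewrite addSn /= leq_addl.
Qed.

Lemma contracted_vanish F p : ~ finvals (fib Y x y p) s -> P F ->
  F.[(p.2)%:P%:P].[(p.1)%:P] = 0.
Proof.
move=> nfin PF; apply/eqP/negPn/negP => n0; apply: nfin.
apply: (van_c1_finvals n0) => v [Yv [vx vy]].
by rewrite /c1 e3_horner; have := PF v Yv; rewrite /c3 vx vy.
Qed.

(* A contracted point [p] is a zero of [A (x, y, s)] for all [s], hence of [A] and of its
   specialisation [A2] at [s = mu]; so [p.1] is a root of the resultant eliminating [y]. *)
Lemma contracted_bound_aux (L : seq (C * C)) : uniq L ->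
  (forall p, p \in L -> ~ finvals (fib Y x y p) s) -> (size L <= 2 * e * e * e)%N.
Proof.
move=> uL HL; have [A [PA A0 sA yA [minA minYA]]] := lexmin_relation.
have sA1 : (1 < size A)%N.
  rewrite ltnNge; apply/negP => /size1_polyC EA; have A00 : A`_0 = 0 by apply: P0; rewrite -EA.
  by move: A0; rewrite EA A00 eqxx.
(* With this [mu] the leading coefficient of [A] survives at s = [mu], so the specialisation keeps
   its degree in y. *)
have [|mu [b lmu]] := @e2_neq0 (lead_coef A); first by rewrite lead_coef_eq0.
pose ev : {rmorphism {poly {poly C}} -> {poly C}} := map_poly (horner_eval mu).
pose cst : {rmorphism {poly C} -> {poly {poly C}}} := map_poly polyC.
pose A1 := map_poly ev A; pose A2 := map_poly cst A1.
have Eev c F : e1 c (ev F) = e2 mu c F.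
  rewrite e1E /e2 extE; congr (_.[_]); apply: eq_map_poly => q.
  by rewrite e1E.
have Ecst a c F : e2 a c (cst F) = e1 c F by rewrite /e2 ext_map_polyC.
have EA2 a c d : e3 a c d A2 = e3 mu c d A.
  rewrite /e3 !extE /A2 /A1 -!map_poly_comp; congr (_.[_]).
  by apply: eq_map_poly => F; rewrite -[LHS]/(e2 a c (cst (ev F))) Ecst Eev.
have lA1 : ev (lead_coef A) != 0 by apply: contraNneq lmu => E; rewrite -Eev E rmorph0.
have lA2 : cst (lead_coef A1) != 0.
  by rewrite /cst /= map_polyC_eq0 lead_coef_eq0 -size_poly_gt0 size_map_poly_id0 // ltnW.
have sA2 : size A2 = size A by rewrite size_map_poly_id0 // size_map_poly_id0.
(* [A2] no longer involves s, and x, y are independent on [Y]. *)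
have nPA2 : ~ P A2.
  move=> PA2; have /ind /eqP : van (c2 x y) Y A1.
    move=> v Yv; have := PA2 v Yv; rewrite /c3 /e3 /A2 extE -map_poly_comp.
    rewrite /c2 /e2 extE => E; rewrite -[RHS]E; congr (_.[_]); apply: eq_map_poly => F.
    by rewrite -[RHS]/(e2 (v 0 s) (v 0 x) (cst F)) Ecst.
  by rewrite -size_poly_eq0 size_map_poly_id0 // gtn_eqF // ltnW.
have yA2 : (sizeY A2 <= sizeY A)%N.
  apply/bigmax_leqP => i _; rewrite !coef_map /=.
  apply: leq_trans (max_size_coefXY A i); rewrite size_map_polyC.
  exact: size_poly.
pose Rs := resultant A A2.
(* Up to constants [A] is [q1 * g] with [g] the common divisor. If [g] were in [P], so would be
   [A2]; hence [q1] is in [P], and minimality of [A] leaves [g] of degree zero in y. *)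
have R0 : Rs != 0.
  rewrite resultant_eq0 -leqNgt; set g := gcdp A A2.
  have g0 : g != 0 by rewrite gcdp_eq0 negb_and A0.
  have /Pdiv.Idomain.dvdpP[[c1 q1] /= c10 E1] : (g %| A) by exact: dvdp_gcdl.
  have /Pdiv.Idomain.dvdpP[[c2 q2] /= c20 E2] : (g %| A2) by exact: dvdp_gcdr.
  have Pg : P q1 \/ P g.
    by apply: (prime_pred_prime Pp); rewrite -E1 -mul_polyC; apply: (prime_predMl Pp).
  case: Pg => [Pq1|Pg]; last first.
    exfalso; have : P (c2%:P * A2) by rewrite mul_polyC E2; apply: (prime_predMl Pp).
    by move/(prime_pred_prime Pp) => [/P0 c2E|//]; rewrite c2E eqxx in c20.
  have q10 : q1 != 0.
    apply: contraNneq A0 => q0; move: E1; rewrite q0 mul0r => /eqP.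
    by rewrite -!size_poly_eq0 size_scale.
  have := minA _ Pq1 q10; rewrite -(@size_scale _ c1 A) // E1 size_mul //.
  have : (0 < size q1)%N by rewrite size_poly_gt0.
  have : (0 < size g)%N by rewrite size_poly_gt0.
  case: (size g) => // -[|n] _ // sq1.
  by rewrite !addnS /= ltnNge leq_addr.
have sR : (size Rs <= (2 * e * e).+1)%N.
  by apply: size_resultant_le => //; rewrite ?sA2 //; apply: leq_trans yA2 yA.
have Rroot p : p \in L -> Rs.[(p.1)%:P] = 0.
  move=> /HL nf; have sA21 : (1 < size A2)%N by rewrite sA2.
  have [[q1 q2] /= _ E] := resultant_in_ideal sA1 sA21.
  have zA := contracted_vanish nf PA.
  have zA2 : A2.[(p.2)%:P%:P].[(p.1)%:P] = 0.
    apply/eqP/negPn/negP => n0; have [a] := e1_neq0 n0.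
    by rewrite e3_horner EA2 -(e3_horner mu) zA rmorph0 eqxx.
  have := congr1 (fun F => F.[(p.2)%:P%:P].[(p.1)%:P]) E.
  by rewrite hornerC !hornerD !hornerM zA zA2 !mulr0 addr0.
pose xs := undup [seq p.1 | p <- L].
have sxs : (size xs <= 2 * e * e)%N.
  rewrite -ltnS; apply: leq_trans sR.
  rewrite -(size_map (fun a : C => a%:P)); apply: max_poly_roots => //.
    apply/allP => _ /mapP[a + ->]; rewrite mem_undup => /mapP[p pL ->].
    by apply/rootP/Rroot.
  by rewrite map_inj_uniq ?undup_uniq //; exact: polyC_inj.
apply: (@leq_trans (size xs * e)); last by rewrite leq_mul2r sxs orbT.
apply: fiberwise_size => [p pL|a]; first by rewrite mem_undup map_f.
(* For a fixed first coordinate [a], the specialisation at x = [a] is nonzero: otherwise x - [a]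
   divides [A] and the quotient contradicts [minYA]. Its degree leaves at most [e] second
   coordinates. *)
pose Aa := map_poly (horner_eval a%:P) A.
have Aa0 : Aa != 0.
  apply/eqP => /factor_inner[B EB].
  have B0 : B != 0 by apply: contraNneq A0 => B0; rewrite EB B0 mulr0.
  have f0 : ('X - a%:P%:P : {poly {poly C}}) != 0 by rewrite polyXsubC_eq0.
  have PB : P B.
    have := PA; rewrite EB => /(prime_pred_prime Pp) [/P0/eqP|//].
    by rewrite (negPf f0).
  have sB : size B = size A by rewrite EB mul_polyC size_scale.
  have := minYA _ PB B0 sB; rewrite EB sizeYM ?polyC_eq0 // sizeYC size_XsubC.
  by rewrite add2n /= ltnn.
have sAa : (size Aa <= e.+1)%N by apply: leq_trans sA; exact: size_poly.
rewrite -ltnS; apply: leq_trans sAa.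
rewrite -(size_map (fun p : C * C => (p.2)%:P)); apply: max_poly_roots => //.
  apply/allP => _ /mapP[p + ->]; rewrite mem_filter => /andP[/eqP pa /HL nf]; apply/rootP.
  have := contracted_vanish nf PA; rewrite pa => E; rewrite -[RHS]E /Aa.
  by rewrite -[in RHS]/(horner_eval _ _) -horner_map /= /horner_eval hornerC.
rewrite map_inj_in_uniq ?filter_uniq // => -[p1 p2] [q1 q2]; rewrite !mem_filter /=.
by move=> /andP[/eqP-> _] /andP[/eqP-> _] /polyC_inj ->.
Qed.
End BothIndep.

(** A single contracted point already makes s independent of x and of y; with no such point there is
    nothing to bound. *)
Lemma contracted_bound (L : seq (C * C)) : uniq L ->
  (forall p, p \in L -> ~ finvals (fib Y x y p) s) -> (size L <= 2 * e * e * e)%N.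
Proof.
case: L => [//|p L] uL HL; apply: contracted_bound_aux => //.
  by apply: (contracted_indep iY (indep2_nonconstant ind) (HL p (mem_head _ _))).
have nf : ~ finvals (fib Y y x (p.2, p.1)) s.
  move=> [f Hf]; apply: (HL p (mem_head _ _)); exists f => v [Yv [vx vy]]; apply: Hf.
  by split.
exact: (contracted_indep iY (indep2_nonconstant (indep2C ind)) nf).
Qed.
End Contracted.

(** * Products of curves *)

(** One elimination step: a function vanishing on [S] but not on [T] is traded for one in fewer
    variables, as long as the dropped coordinate is algebraic over the others on [T]. *)
Lemma eliminate_variable (R : idomainType) (chi : pt -> {rmorphism R -> C}) t (T S : pt -> Prop)
    (F g : {poly R}) : prime_set T -> pfam chi -> pfun t -> subset4 S T ->
  van (fun v => ext (chi v) (t v)) T F -> ~ van chi T (lead_coef F) ->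
  ~ van (fun v => ext (chi v) (t v)) T g -> van (fun v => ext (chi v) (t v)) S g ->
  exists r, ~ van chi T r /\ van chi S r.
Proof.
move=> pT pc pt sST vF lF ng vg.
have Pp := van_prime pT (pfam_ext pc pt).
have [|w [r [nr vr]]] := relation_unit Pp vF _ ng; first by move=> /van_extC.
exists r; split; first by move=> vr1; apply/nr/van_extC.
move=> v Sv; have := vr v (sST v Sv).
by rewrite rmorphB extC rmorphM (vg v Sv) mulr0 subr0.
Qed.

(** With finitely many values, the product of the factors ['X - c%:P] vanishes on [Z]; by primality
    one factor does, and the coordinate is constant. *)
Lemma irreducible_infvals Z (p q : pt) i : irreducible Z -> Z p -> Z q -> p 0 i != q 0 i ->
  ~ finvals Z i.
Proof.
move=> iZ Zp Zq pq [s Hs].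
have P1 := van_prime (irreducible_prime_set iZ) (pfam_c1 i).
have [c vc] : exists c, van (c1 i) Z ('X - c%:P).
  have : van (c1 i) Z (\prod_(c <- s) ('X - c%:P)).
    move=> v Zv; rewrite /c1 e1E; apply/rootP; rewrite root_prod_XsubC; exact: Hs.
  elim: s {Hs} => [|c s IHs]; first by rewrite big_nil => /(prime_pred1 P1).
  by rewrite big_cons => /(prime_pred_prime P1) [vc|/IHs]; first by exists c.
have E v : Z v -> v 0 i = c.
  by move=> /vc; rewrite /c1 e1E hornerXsubC => /subr0_eq.
by rewrite !E // eqxx in pq.
Qed.

Section EmbedPairs.
Variables (i j k l : 'I_4).

Lemma c3_embed_outer v (B : {poly {poly C}}) :
  c3 i j k v (map_poly polyC B) = c2 i k v B.
Proof. exact: ext_map_polyC. Qed.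

Lemma c3_embed_inner v (B : {poly {poly C}}) :
  c3 i j k v (map_poly (map_poly polyC) B) = c2 j k v B.
Proof.
rewrite /c3 /e3 /c2 /e2 !extE -map_poly_comp; congr (_.[_]); apply: eq_map_poly => F.
exact: ext_map_polyC.
Qed.

Lemma c4_embed_outer v (B : {poly {poly C}}) :
  c4 i j k l v (map_poly (polyC \o polyC) B) = c2 i l v B.
Proof.
rewrite /c4 /e4 /c2 /e2 !extE -map_poly_comp; congr (_.[_]); apply: eq_map_poly => F.
by rewrite -[LHS]/(e3 (v 0 i) (v 0 j) (v 0 k) F%:P%:P) /e3 /e2 !extC.
Qed.
End EmbedPairs.

Lemma lead_coef_embed (R S : nzRingType) (f : {rmorphism R -> S}) (B : {poly R}) :
  injective f -> lead_coef (map_poly f B) = f (lead_coef B).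
Proof. by move=> fi; rewrite lead_coef_map_inj // rmorph0. Qed.

(** In a chain of length two the middle set [Z] has a coordinate with infinitely many values, over
    which all others are algebraic. A function vanishing on [Z] but not on [Y] is then eliminated
    down to a nonzero polynomial in that coordinate vanishing on [Z]. *)
Lemma dependent_pairs_chain Y : irreducible Y ->
  (forall i j, i != j -> ~ indep2 Y i j) -> ~ chain_in Y 2.
Proof.
move=> iY dep [W [HW dW]].
have [iZ sZ] := HW 1%N isT; have [_ sW2] := HW 2%N isT.
have [_ [y [Wy nWy]]] := dW 1%N isT.
have [[_ [p Wp] _] _] := HW 0%N isT; have [s01 [q [Wq nWq]]] := dW 0%N isT.
set Z := W 1%N in iZ sZ nWy Wq s01; have Zp := s01 _ Wp.
have [i1 Hi] : exists i, p 0 i != q 0 i by apply: neq_coord => E; apply: nWq; rewrite -E.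
have nfin := irreducible_infvals iZ Zp Wq Hi.
have nv F : F != 0 -> ~ van (c1 i1) Y F.
  by move=> F0 vF; apply: nfin; apply: (van_c1_finvals F0) => v /sZ; exact: vF.
have [i2 [i3 [i4 u]]] : exists i2 i3 i4, uniq [:: i1; i2; i3; i4].
  have : size (rem i1 (enum 'I_4)) = 3 by rewrite size_rem ?mem_enum // size_enum_ord.
  have ur : uniq (i1 :: rem i1 (enum 'I_4)).
    by rewrite /= rem_uniq ?enum_uniq // mem_rem_uniq ?enum_uniq // !inE eqxx.
  case E: (rem i1 (enum 'I_4)) ur => [|i2 [|i3 [|i4 [|]]]] // ur _.
  by exists i2, i3, i4.
have pY := irreducible_prime_set iY.
have depB j : i1 != j -> exists B, van (c2 i1 j) Y B /\ B != 0.
  move=> /dep /not_all_ex_not[B nB]; have [vB /eqP B0] := imply_to_and _ _ nB.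
  by exists B.
move: (u); rewrite /= !inE !negb_or => /and4P[/and3P[n12 n13 n14] _ _ _].
have [B4 [vB4 B40]] := depB _ n14; have [B3 [vB3 B30]] := depB _ n13; have [B2 [vB2 B20]] := depB _ n12.
have [aZ _ _] := iZ.
have [f [vf nf]] : exists f, (forall v, Z v -> peval f v = 0) /\ peval f y != 0.
  exact: algset_separate.
have Yy : Y y by exact: sW2.
have [||||r3 [nr3 vr3]] := @eliminate_variable _ (c3 i1 i2 i3) (fun v => v 0 i4) Y Z
    (map_poly (polyC \o polyC) B4) (iter_poly i1 i2 i3 f) pY (pfam_c3 _ _ _) (pfun_coord i4) sZ.
- by move=> v Yv; rewrite [LHS](c4_embed_outer i1 i2 i3 i4 v B4); exact: vB4.
- rewrite lead_coef_embed; last by move=> a b /polyC_inj /polyC_inj.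
  by move=> /van_extC /van_extC; apply: nv; rewrite lead_coef_eq0.
- by move=> /(_ y Yy) /eqP; rewrite [X in X == 0](c4_iter_poly u) (negPf nf).
- by move=> v Zv; rewrite [LHS](c4_iter_poly u); exact: vf.
have [||r2 [nr2 vr2]] := @eliminate_variable _ (c2 i1 i2) (fun v => v 0 i3) Y Z
    (map_poly polyC B3) r3 pY (pfam_c2 _ _) (pfun_coord i3) sZ _ _ nr3 vr3.
- by move=> v Yv; rewrite [LHS](c3_embed_outer i1 i2 i3 v B3); exact: vB3.
- rewrite lead_coef_embed; last exact: polyC_inj.
  by move=> /van_extC; apply: nv; rewrite lead_coef_eq0.
have [|r1 [nr1 vr1]] := @eliminate_variable _ (c1 i1) (fun v => v 0 i2) Y Z
    B2 r2 pY (pfam_c1 _) (pfun_coord i2) sZ vB2 _ nr2 vr2.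
  by apply: nv; rewrite lead_coef_eq0.
apply: nfin; apply: van_c1_finvals vr1; apply/eqP => r10; apply: nr1 => v _.
by rewrite r10 rmorph0.
Qed.

Definition mix (a b : pt) : pt := \row_i (if (i < 2)%N then a 0 i else b 0 i).

Definition proj_product (Y : pt -> Prop) (v : pt) := exists a b, [/\ Y a, Y b & v = mix a b].

Lemma proj_product_sub Y : subset4 Y (proj_product Y).
Proof.
move=> v Yv; exists v, v; split=> //; apply/rowP => i; by rewrite mxE if_same.
Qed.

(* If [f] and [g] are nonzero somewhere, primality in the last two coordinates and
   then in the first two moves both witnesses to a common point. *)
Lemma prime_set_proj_product Y : prime_set Y -> prime_set (proj_product Y).
Proof.
move=> [[v0 Yv0] pY]; split; first by exists v0; apply: proj_product_sub.
move=> f g [F EF] [G EG] fg; apply: NNPP => /not_or_and[nf ng].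
have wit (h : pt -> C) : ~ (forall v, proj_product Y v -> h v = 0) ->
    exists a b, [/\ Y a, Y b & h (mix a b) != 0].
  move=> nh; apply: NNPP => no; apply: nh => v [a [b [Ya Yb ->]]].
  by apply/eqP/negPn/negP => n0; apply: no; exists a, b.
have [a1 [b1 [Ya1 Yb1 n1]]] := wit f nf; have [a2 [b2 [Ya2 Yb2 n2]]] := wit g ng.
have both h1 h2 : pfun h1 -> pfun h2 -> (exists2 v, Y v & h1 v != 0) ->
    (exists2 v, Y v & h2 v != 0) -> exists2 v, Y v & h1 v * h2 v != 0.
  move=> ph1 ph2 [v1 Yv1 m1] [v2 Yv2 m2]; apply: NNPP => no.
  case: (pY h1 h2 ph1 ph2) => [v Yv|H|H].
  - by apply/eqP/negPn/negP => m; apply: no; exists v.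
  - by rewrite H ?eqxx in m1.
  - by rewrite H ?eqxx in m2.
have pr a (H : {mpoly C[4]}) : pfun (fun v => peval H (mix a v)).
  apply: pfun_comp => i; case: (ltnP i 2) => lt.
    by apply: pfun_eq (pfun_const (a 0 i)) => v; rewrite mxE lt.
  by apply: pfun_eq (pfun_coord i) => v; rewrite mxE ltnNge lt.
have pl b (H : {mpoly C[4]}) : pfun (fun v => peval H (mix v b)).
  apply: pfun_comp => i; case: (ltnP i 2) => lt.
    by apply: pfun_eq (pfun_coord i) => v; rewrite mxE lt.
  by apply: pfun_eq (pfun_const (b 0 i)) => v; rewrite mxE ltnNge lt.
have [||b Yb] := both _ _ (pr a1 F) (pr a2 G).
- by exists b1 => //; rewrite -EF.
- by exists b2 => //; rewrite -EG.
rewrite mulf_eq0 negb_or => /andP[m1 m2].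
have [||a Ya] := both _ _ (pl b F) (pl b G).
- by exists a1.
- by exists a2.
by rewrite -EF -EG fg ?eqxx //; exists a, b.
Qed.

(** * The vanishing ideal of a product of two plane curves *)

Section ProductIdeal.
Variables (Y : pt -> Prop) (u u' w w' : 'I_4).
Hypotheses (iY : irreducible Y) (uq : uniq [:: w; u; u'; w']).
Hypotheses (lu : (u < 2)%N) (lu' : (u' < 2)%N) (lw : (2 <= w)%N) (lw' : (2 <= w')%N).
Hypotheses (ind : indep2 Y w u) (du : ~ indep2 Y u u') (dw : ~ indep2 Y w w').
Let pY := irreducible_prime_set iY.
Let T := proj_product Y.

Lemma van_proj_product_l F : van (c2 u u') Y F -> van (c2 u u') T F.
Proof. by move=> vF _ [a [b [Ya _ ->]]]; rewrite /c2 !mxE lu lu'; exact: vF. Qed.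

Lemma van_proj_product_r F : van (c2 w w') Y F -> van (c2 w w') T F.
Proof.
by move=> vF _ [a [b [_ Yb ->]]]; rewrite /c2 !mxE (leq_gtF lw) (leq_gtF lw'); exact: vF.
Qed.

Lemma transcendental_w F : van (c1 w) Y F -> F = 0.
Proof.
by move=> vF; have /ind/eqP : van (c2 w u) Y F%:P by [apply/van_extC]; rewrite polyC_eq0 => /eqP.
Qed.

Lemma transcendental_u F : van (c1 u) Y F -> F = 0.
Proof.
move=> vF; have /(indep2C ind)/eqP : van (c2 u w) Y F%:P by apply/van_extC.
by rewrite polyC_eq0 => /eqP.
Qed.

(** The relations for [u'] over [u] and for [w'] over [w] each involve one factor, so they persist
    on [T]. They reduce a function vanishing on [Y] but not on [T] to a polynomial in [w] and [u],
    which independence on [Y] forces to be zero. *)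
Lemma vanish_proj_product f : (forall v, Y v -> peval f v = 0) -> forall v, T v -> peval f v = 0.
Proof.
move=> vf v0 Tv0; apply/eqP/negPn/negP => nf.
have pT := prime_set_proj_product pY.
have sYT : subset4 Y T := @proj_product_sub Y.
have [B nB] := not_all_ex_not _ _ dw; have [vB /eqP B0] := imply_to_and _ _ nB.
have [B' nB'] := not_all_ex_not _ _ du; have [vB' /eqP B'0] := imply_to_and _ _ nB'.
have [||||r3 [nr3 vr3]] := @eliminate_variable _ (c3 w u u') (fun v => v 0 w') T Y
    (map_poly (polyC \o polyC) B) (iter_poly w u u' f) pT (pfam_c3 _ _ _) (pfun_coord w') sYT.
- move=> v Tv; rewrite [LHS](c4_embed_outer w u u' w' v B); exact: van_proj_product_r.
- rewrite lead_coef_embed; last by move=> a b /polyC_inj /polyC_inj.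
  move=> /van_extC /van_extC /(vanS sYT) /transcendental_w /eqP.
  by rewrite lead_coef_eq0 (negPf B0).
- by move=> /(_ v0 Tv0) /eqP; rewrite [X in X == 0](c4_iter_poly uq) (negPf nf).
- by move=> v Yv; rewrite [LHS](c4_iter_poly uq); exact: vf.
have [||r2 [nr2 vr2]] := @eliminate_variable _ (c2 w u) (fun v => v 0 u') T Y
    (map_poly (map_poly polyC) B') r3 pT (pfam_c2 _ _) (pfun_coord u') sYT _ _ nr3 vr3.
- move=> v Tv; rewrite [LHS](c3_embed_inner w u u' v B'); exact: van_proj_product_l.
- rewrite lead_coef_embed; last by apply: map_inj_poly; [exact: polyC_inj|].
  move=> /(vanS sYT) /ind /eqP; rewrite map_polyC_eq0 lead_coef_eq0.
  by rewrite (negPf B'0).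
by apply: nr2 => v _; rewrite (ind vr2) rmorph0.
Qed.
End ProductIdeal.

(** A relation of least degree in [u'], then in [u], generates: by Gauss's lemma it divides every
    member up to a constant, here an invertible complex number. *)
Lemma principal_ideal Y u u' : irreducible Y -> (forall F, van (c1 u) Y F -> F = 0) ->
  ~ indep2 Y u u' -> exists A, [/\ A != 0, van (c2 u u') Y A &
    forall F, van (c2 u u') Y F -> exists Q, F = Q * A].
Proof.
move=> iY tr /not_all_ex_not[B nB]; have [vB /eqP B0] := imply_to_and _ _ nB.
have Pp := van_prime (irreducible_prime_set iY) (pfam_c2 u u').
have [|A1 [[PA1 A10] minA1]] := @exists_minimal _ (fun F => van (c2 u u') Y F /\ F != 0)
    (fun F : {poly {poly C}} => size F); first by exists B.
have [|A [[PA A0 sA] minYA]] := @exists_minimal _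
   (fun F => [/\ van (c2 u u') Y F, F != 0 & size F = size A1]) (@sizeY _).
  by exists A1.
exists A; split=> // F vF.
have P0 p : van (c2 u u') Y p%:P -> p = 0 by move/van_extC/tr.
have [|F1 v1 n1 s1|c [Q [c0 E]]] := gauss_divides Pp P0 PA A0 _ _ vF.
- by move=> F1 v1 n1; rewrite sA; apply: minA1.
- by apply: minYA; rewrite -sA.
exists ((c^-1)%:P%:P * Q); rewrite -mulrA -E mulrA -!polyCM mulVf // mul1r //.
Qed.

Definition iota2 (u u' : 'I_4) : {rmorphism {poly {poly C}} -> {mpoly C[4]}} :=
  ext (ext (@mpolyC 4 C : {rmorphism C -> {mpoly C[4]}}) 'X_u) 'X_u'.

Lemma peval_iota2 u u' v F : peval (iota2 u u' F) v = c2 u u' v F.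
Proof.
have morph_ext (R S K : comNzRingType) (chi : {rmorphism R -> S}) (chi' : {rmorphism R -> K})
   (phi : {rmorphism S -> K}) t (G : {poly R}) :
   (forall a, phi (chi a) = chi' a) -> phi (ext chi t G) = ext chi' (phi t) G.
  move=> E; rewrite extE -horner_map -map_poly_comp; congr (_.[_]).
  exact: eq_map_poly.
have E : forall a : {poly C}, meval (fun i => v 0 i) (ext (@mpolyC 4 C : {rmorphism _ -> _}) 'X_u a) = c1 u v a.
  move=> a; rewrite (@morph_ext _ _ _ _ (idfun : {rmorphism C -> C})).
    by rewrite /= mevalXU.
  by move=> b; exact: mevalC.
rewrite /peval /iota2 (@morph_ext _ _ _ _ (c1 u v)) //.
by rewrite /= mevalXU.
Qed.

Definition free_of (i : 'I_4) (G : {mpoly C[4]}) := forall m, m \in msupp G -> m i = 0%N.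

Lemma free_of_ext (R : comNzRingType) (chi : {rmorphism R -> {mpoly C[4]}}) i j F : i != j ->
  (forall a, free_of i (chi a)) -> free_of i (ext chi 'X_j F).
Proof.
move=> ij fc; elim/poly_ind: F => [|F a IHF] m.
  by rewrite rmorph0 msupp0.
rewrite rmorphD rmorphM extX extC => /msuppD_le; rewrite mem_cat => /orP[|/fc //].
move=> /msuppM_le /allpairsP[[m1 m2] /= [/IHF E1 + ->]].
rewrite msuppX inE => /eqP->; rewrite mnmDE E1 mnm1E eq_sym (negPf ij) //.
Qed.

Lemma free_of_iota2 u u' i F : i != u -> i != u' -> free_of i (iota2 u u' F).
Proof.
move=> iu iu'; apply: free_of_ext => // a; apply: free_of_ext => // c m.
by rewrite /= msuppC; case: ifP => // _; rewrite inE => /eqP->; rewrite mnm0E.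
Qed.

Lemma iota2_monomial u u' (c : C) a b :
  iota2 u u' (c%:P%:P * ('X%:P ^+ a * 'X ^+ b)) = c%:MP * ('X_u ^+ a * 'X_u' ^+ b).
Proof. by rewrite /iota2 !rmorphM !rmorphXn !extX !extC !extX. Qed.

Section Tensor.
Variables (u u' w w' : 'I_4).
Hypothesis uq : uniq [:: u; u'; w; w'].

Lemma tensor_expansion f : exists L : seq ({poly {poly C}} * {poly {poly C}}),
  f = \sum_(p <- L) iota2 u u' p.1 * iota2 w w' p.2.
Proof.
exists [seq ((f@_m)%:P%:P * ('X%:P ^+ m u * 'X ^+ m u'), 1%:P%:P * ('X%:P ^+ m w * 'X ^+ m w')) | m <- msupp f].
rewrite big_map [LHS]mpolyE; apply: eq_bigr => m _.
rewrite -[RHS]/(iota2 u u' ((f@_m)%:P%:P * ('X%:P ^+ m u * 'X ^+ m u')) *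
                iota2 w w' (1%:P%:P * ('X%:P ^+ m w * 'X ^+ m w'))) !iota2_monomial.
rewrite mpolyC1 mul1r -mulrA -mul_mpolyC; congr (_ * _); rewrite mpolyXE_id.
have -> : \prod_(i < 4) 'X_i ^+ m i = \prod_(i <- [:: u; u'; w; w']) 'X_i ^+ m i :> {mpoly C[4]}.
  apply: perm_big; apply: uniq_perm; rewrite ?index_enum_uniq // => i.
  by rewrite mem_index_enum cover4.
by rewrite !big_cons big_nil mulr1 !mulrA.
Qed.

Variables (Y : pt -> Prop) (A B : {poly {poly C}}).
Hypothesis HA : forall F, van (c2 u u') Y F -> exists Q, F = Q * A.
Hypothesis HB : forall F, van (c2 w w') Y F -> exists Q, F = Q * B.

(* Each step shortens the list: if [f] does not vanish at some [a] in [Y], then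
   specialising the first two coordinates at [a] expresses [g] through the other
   second factors modulo [B]. *)
Lemma tensor_ideal (L : seq ({poly {poly C}} * {poly {poly C}})) :
  (forall a b, Y a -> Y b -> \sum_(p <- L) c2 u u' a p.1 * c2 w w' b p.2 = 0) ->
  GK_cartesian (iota2 u u' A) (iota2 w w' B) (\sum_(p <- L) iota2 u u' p.1 * iota2 w w' p.2).
Proof.
have [n] := ubnP (size L); elim: n L => // n IHn [|[f g] L] sL vL.
  by exists 0, 0; rewrite big_nil !mulr0 addr0.
case: (classic (van (c2 u u') Y f)) => [vf|nvf].
  have [Q ->] := HA vf.
  have [a b Ya Yb|H [K E]] := IHn L sL.
    have := vL a b Ya Yb; rewrite big_cons -[X in X + _]/(c2 u u' a f * c2 w w' b g).
    by rewrite vf // mul0r add0r.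
  exists (iota2 u u' Q * iota2 w w' g + H), K; rewrite big_cons.
  by rewrite -[X in X + _]/(iota2 u u' (Q * A) * iota2 w w' g) E rmorphM; ring.
have [a Ya fa] : exists2 a, Y a & c2 u u' a f != 0.
  apply: NNPP => no; apply: nvf => a Ya; apply/eqP/negPn/negP => fa; apply: no; by exists a.
(* Dividing by the value of [f] at [a] solves the relation along the slice at [a] for [g]; hence [k]
   vanishes on [Y]. *)
pose co (q : {poly {poly C}}) : C := c2 u u' a q / c2 u u' a f.
pose k := g + \sum_(p <- L) (co p.1)%:P%:P * p.2.
have e2C (i j : 'I_4) v (c : C) : c2 i j v c%:P%:P = c by rewrite /c2 /e2 /e1 !extC.
have Ek b : c2 w w' b k = c2 w w' b g + \sum_(p <- L) co p.1 * c2 w w' b p.2.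
  rewrite /k rmorphD rmorph_sum; congr (_ + _); apply: eq_bigr => p _.
  by rewrite rmorphM e2C.
have vk : van (c2 w w') Y k.
  move=> b Yb; have := vL a b Ya Yb; rewrite big_cons -[X in X + _]/(c2 u u' a f * c2 w w' b g) Ek => E.
  apply: (mulfI fa); rewrite mulr0 -[RHS]E mulrDr mulr_sumr; congr (_ + _).
  by apply: eq_bigr => p _; rewrite mulrA /co mulrCA divff // mulr1.
have [Q EQ] := HB vk.
(* Replacing [g] by [k] minus the weighted sum moves multiples of [f] into the other first factors:
   the original sum is that of [L'] plus [f] times [k], a multiple of [B]. *)
pose L' := [seq (p.1 - (co p.1)%:P%:P * f, p.2) | p <- L].
have [|a' b' Ya' Yb'|H [K E]] := IHn L'; first by rewrite size_map.
  have := vL a' b' Ya' Yb'; rewrite big_cons -[X in X + _]/(c2 u u' a' f * c2 w w' b' g) => E.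
  have := vk b' Yb'; rewrite Ek => Ek0.
  have Eg : c2 w w' b' g = - \sum_(p <- L) co p.1 * c2 w w' b' p.2 by apply/eqP; rewrite -addr_eq0; apply/eqP.
  rewrite big_map -[RHS]E Eg mulrN mulr_sumr -sumrN -big_split; apply: eq_bigr => p _.
  rewrite -[LHS]/(c2 u u' a' (p.1 - (co p.1)%:P%:P * f) * c2 w w' b' p.2).
  by rewrite rmorphB rmorphM e2C [RHS]addrC; ring.
have iC (i j : 'I_4) (c : C) : iota2 i j c%:P%:P = c%:MP by rewrite /iota2 !extC.
exists H, (K + iota2 u u' f * iota2 w w' Q).
rewrite big_cons -[X in X + _]/(iota2 u u' f * iota2 w w' g).
have Eg : iota2 w w' g = iota2 w w' Q * iota2 w w' B - \sum_(p <- L) (co p.1)%:MP * iota2 w w' p.2.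
  rewrite -rmorphM -EQ /k rmorphD rmorph_sum.
  rewrite -[LHS]addr0 -addrA; congr (_ + _); apply/esym/eqP; rewrite subr_eq0; apply/eqP.
  by apply: eq_bigr => p _; rewrite rmorphM iC.
transitivity ((\sum_(p <- L') iota2 u u' p.1 * iota2 w w' p.2) + iota2 u u' f * (iota2 w w' Q * iota2 w w' B)).
  rewrite Eg mulrBr [RHS]addrC -addrA; congr (_ + _).
  rewrite big_map mulr_sumr addrC -sumrB; apply: eq_bigr => p _.
  rewrite -[RHS]/(iota2 u u' (p.1 - (co p.1)%:P%:P * f) * iota2 w w' p.2).
  by rewrite rmorphB [iota2 u u' (_ * f)]rmorphM iC; ring.
by rewrite E; ring.
Qed.
End Tensor.

Lemma iota2_nonconstant Y u u' A v0 : u != u' -> A != 0 -> Y v0 -> van (c2 u u') Y A ->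
  nonconstant (iota2 u u' A).
Proof.
move=> uu A0 Yv0 vA [c E].
have c0 : c = 0 by have := vA v0 Yv0; rewrite -peval_iota2 E /peval mevalC.
have [a [b /eqP]] := e2_neq0 A0; apply.
pose v : pt := \row_i (if i == u then a else b).
have := peval_iota2 u u' v A; rewrite E c0 /peval mevalC /c2 !mxE eqxx eq_sym (negPf uu) => <- //.
Qed.

Lemma cartesian_of_indep (X Y : pt -> Prop) (u u' w w' : 'I_4) :
  irreducible Y -> subset4 Y X -> uniq [:: w; u; u'; w'] ->
  (u < 2)%N -> (u' < 2)%N -> (2 <= w)%N -> (2 <= w')%N ->
  indep2 Y w u -> ~ indep2 Y u u' -> ~ indep2 Y w w' -> cartesian X.
Proof.
move=> iY sYX uq lu lu' lw lw' ind du dw.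
have [_ [v0 Yv0] _] := iY.
have [A [A0 vA HA]] := principal_ideal iY (transcendental_u ind) du.
have [B [B0 vB HB]] := principal_ideal iY (transcendental_w ind) dw.
have uq' : uniq [:: u; u'; w; w'].
  move: uq; rewrite /= !inE !negb_or ![w == _]eq_sym => /and4P[/and3P[-> -> ->] /andP[-> ->] ->] //.
have nlt (i j : 'I_4) : (i < 2)%N -> (2 <= j)%N -> j != i.
  by move=> li lj; apply/eqP => E; move: lj; rewrite E leqNgt li.
exists (iota2 u u' A), (iota2 w w' B); split.
- by move=> m mA; split; apply: free_of_iota2 mA; apply: nlt; rewrite ?inordK.
- apply: iota2_nonconstant A0 Yv0 vA; by move: uq'; rewrite /= !inE negb_or => /andP[/andP[]].
- by move=> m mA; split; apply: free_of_iota2 mA; rewrite eq_sym; apply: nlt; rewrite ?inordK.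
- apply: iota2_nonconstant B0 Yv0 vB; by move: uq'; rewrite /= !inE => /and4P[].
move=> f vf.
have vfT := @vanish_proj_product Y u u' w w' iY uq lu lu' lw lw' ind du dw f
  (fun v Yv => vf v (sYX v Yv)).
have [L EL] := tensor_expansion uq' f; rewrite [f]EL; apply: (tensor_ideal HA HB) => a b Ya Yb.
have Tab : proj_product Y (mix a b) by exists a, b.
transitivity (peval f (mix a b)); last exact: vfT.
rewrite [in RHS]EL /peval raddf_sum; apply: eq_bigr => p _.
rewrite -[RHS]/(meval _ (iota2 u u' p.1 * iota2 w w' p.2)) mevalM -!/(peval _ _) !peval_iota2 /c2 !mxE.
by rewrite lu lu' (leq_gtF lw) (leq_gtF lw').
Qed.

(** Dimension two forces some pair of coordinates to be independent; with both natural pairs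
    dependent it takes one coordinate from each plane. *)
Lemma cartesian_of_dependent (X Y : pt -> Prop) : irreducible Y -> subset4 Y X -> chain_in Y 2 ->
  ~ indep2 Y (inord 0) (inord 1) -> ~ indep2 Y (inord 2) (inord 3) -> cartesian X.
Proof.
move=> iY sYX cY d01 d23; apply: NNPP => ncart; apply: (dependent_pairs_chain iY _ cY).
have d10 : ~ indep2 Y (inord 1) (inord 0) by move=> /indep2C.
have d32 : ~ indep2 Y (inord 3) (inord 2) by move=> /indep2C.
have hi (i : 'I_4) : (2 <= i)%N -> i = inord 2 \/ i = inord 3.
  by case: i => -[|[|[|[|]]]] // p _; [left|right]; apply: val_inj; rewrite /= inordK.
have lo (i : 'I_4) : (i < 2)%N -> i = inord 0 \/ i = inord 1.
  by case: i => -[|[|]] // p _; [left|right]; apply: val_inj; rewrite /= inordK.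
have nlt (a b : 'I_4) : (a < 2)%N -> (2 <= b)%N -> b != a.
  by move=> la lb; apply/eqP => E; move: lb; rewrite E leqNgt la.
have key (i j : 'I_4) : (2 <= i)%N -> (j < 2)%N -> ~ indep2 Y i j.
  move=> li lj ind; apply: ncart.
  have [i' [li' ni' di]] : exists i' : 'I_4, [/\ (2 <= i')%N, i != i' & ~ indep2 Y i i'].
    by case: (hi i li) => ->; [exists (inord 3)|exists (inord 2)]; rewrite -val_eqE /= !inordK.
  have [j' [lj' nj' dj]] : exists j' : 'I_4, [/\ (j' < 2)%N, j != j' & ~ indep2 Y j j'].
    by case: (lo j lj) => ->; [exists (inord 1)|exists (inord 0)]; rewrite -val_eqE /= !inordK.
  apply: (@cartesian_of_indep X Y j j' i i') => //.
  by rewrite /= !inE !negb_or ni' nj' ![_ == i']eq_sym !nlt.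
move=> i j ij; case: (ltnP i 2) (ltnP j 2) => [li|li] [lj|lj].
- by move: ij; case: (lo i li) => ->; case: (lo j lj) => -> //; rewrite eqxx.
- by move=> /indep2C; exact: key.
- exact: key.
- by move: ij; case: (hi i li) => ->; case: (hi j lj) => -> //; rewrite eqxx.
Qed.

(** * Counting incidences *)

Definition asb (S : Prop) : bool := excluded_middle_informative S.

Lemma asbP (S : Prop) : reflect S (asb S).
Proof. by rewrite /asb; case: excluded_middle_informative => H; constructor. Qed.

(** Each good row contributes at most [e], and each of at most [b] bad rows at most the size of
    [Q]. *)
Lemma sum_bad_rows (T U : eqType) (r : T -> U -> bool) (bad : T -> Prop) (P : seq T) (Q : seq U) e b :
  uniq P -> (forall p, ~ bad p -> (count (r p) Q <= e)%N) ->
  (forall L, uniq L -> (forall p, p \in L -> bad p) -> (size L <= b)%N) ->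
  (\sum_(p <- P) \sum_(q <- Q) r p q <= (e + b) * (size P + size Q))%N.
Proof.
move=> uP good few.
have H : (\sum_(p <- P) \sum_(q <- Q) r p q <= e * size P + count (fun p => asb (bad p)) P * size Q)%N.
  elim: P {uP} => [|p P IHP]; first by rewrite big_nil.
  rewrite big_cons /=; have -> : (\sum_(q <- Q) r p q = count (r p) Q)%N.
    by rewrite -sum1_count [RHS]big_mkcond; apply: eq_bigr => q _; case: (r p q).
  case: asbP => [_|/good gp]; last by lia.
  by have := count_size (r p) Q; lia.
have := few (filter (fun p => asb (bad p)) P) (filter_uniq _ uP).
rewrite size_filter => /(_ _)/wrap[]; first by move=> p; rewrite mem_filter => /andP[/asbP].
move=> cb; apply: (leq_trans H); rewrite mulnDr !mulnDl.
have := leq_mul2r (size Q) (count (fun p => asb (bad p)) P) b; rewrite cb orbT; lia.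
Qed.

Local Notation i0 := (inord 0 : 'I_4).
Local Notation i1 := (inord 1 : 'I_4).
Local Notation i2 := (inord 2 : 'I_4).
Local Notation i3 := (inord 3 : 'I_4).

Lemma pt_ofE p q : [/\ pt_of p q 0 i0 = p.1, pt_of p q 0 i1 = p.2,
  pt_of p q 0 i2 = q.1 & pt_of p q 0 i3 = q.2].
Proof. by rewrite !mxE !inordK. Qed.

Lemma pt_of_inj p q p' q' : pt_of p q = pt_of p' q' -> p = p' /\ q = q'.
Proof.
move=> E; have [a1 a2 a3 a4] := pt_ofE p q; have [b1 b2 b3 b4] := pt_ofE p' q'.
rewrite -E in b1 b2 b3 b4; rewrite [p]surjective_pairing [q]surjective_pairing.
by rewrite -a1 -a2 -a3 -a4 b1 b2 b3 b4 -!surjective_pairing.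
Qed.

Lemma count_image (T : eqType) (f : T -> pt) (Y : pt -> Prop) (Q : seq T) e : uniq Q ->
  injective f ->
  (forall s, uniq s -> (forall x, x \in s -> Y x /\ exists q, x = f q) -> (size s <= e)%N) ->
  (count (fun q => asb (Y (f q))) Q <= e)%N.
Proof.
move=> uQ fi H; rewrite -size_filter -(size_map f); apply: H.
  by rewrite map_inj_uniq // filter_uniq.
by move=> x /mapP[q]; rewrite mem_filter => /andP[/asbP Yq _] ->; split=> //; exists q.
Qed.

Lemma dim2_few_contracted Y e x y s t (L : seq (C * C)) : irreducible Y ->
  uniq [:: s; x; y; t] -> irr_degree Y 2 e -> ~ chain_in Y 3 -> indep2 Y x y ->
  uniq L -> (forall p, p \in L -> ~ finite4 (fib Y x y p)) -> (size L <= 2 * (2 * e * e * e))%N.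
Proof.
move=> iY u de nY ind uL HL.
have u' : uniq [:: t; x; y; s].
  move: u; rewrite /= !inE !negb_or ![t == _]eq_sym => /and4P[/and3P[ns1 ns2 nst] /andP[nxy nxt] nyt _].
  by rewrite nxt nyt nst nxy ![_ == s]eq_sym ns1 ns2.
pose L1 := [seq p <- L | asb (~ finvals (fib Y x y p) s)].
pose L2 := [seq p <- L | asb (~ finvals (fib Y x y p) t)].
have h1 : (size L1 <= 2 * e * e * e)%N.
  apply: (contracted_bound iY u de nY ind); first exact: filter_uniq.
  by move=> p; rewrite mem_filter => /andP[/asbP].
have h2 : (size L2 <= 2 * e * e * e)%N.
  apply: (contracted_bound iY u' de nY ind); first exact: filter_uniq.
  by move=> p; rewrite mem_filter => /andP[/asbP].
have : (size L <= size (L1 ++ L2))%N.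
  apply: uniq_leq_size => // p pL; rewrite mem_cat !mem_filter pL !andbT.
  apply/orP; apply: NNPP => /not_or_and[n1 n2]; apply: (HL p pL).
  have {}n1 : finvals (fib Y x y p) s by apply: NNPP => ?; apply: n1; apply/asbP.
  have {}n2 : finvals (fib Y x y p) t by apply: NNPP => ?; apply: n2; apply/asbP.
  apply: finvals_finite4 => i; have := cover4 u i; rewrite !inE => /or4P[]/eqP-> //.
  - by exists [:: p.1] => v [_ [-> _]]; rewrite inE.
  - by exists [:: p.2] => v [_ [_ ->]]; rewrite inE.
by rewrite size_cat; lia.
Qed.

(** [e] bounds a finite fibre; the cubic term counts contracted points for each of the two remaining
    coordinates; 1 accounts for a curve lying over a single point. *)
Definition component_const e := (e + 2 * (2 * e * e * e) + 1)%N.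

Lemma component_const_le e d : (e <= d)%N -> (component_const e <= component_const d)%N.
Proof. by move=> ed; rewrite /component_const !leq_add // !leq_mul. Qed.

Lemma component_bound X Y k e (P Q : seq (C * C)) : irreducible Y -> has_dim Y k ->
  irr_degree Y k e -> (k <= 2)%N -> subset4 Y X -> ~ cartesian X -> uniq P -> uniq Q ->
  (\sum_(p <- P) \sum_(q <- Q) asb (Y (pt_of p q)) <= component_const e * (size P + size Q))%N.
Proof.
move=> iY dY de k2 sYX ncart uP uQ; have [aY [v0 Yv0] _] := iY; have [cY nY] := dY.
have injr p : injective (pt_of p) by move=> q q' /pt_of_inj[].
have injl q : injective (pt_of^~ q) by move=> p p' /pt_of_inj[].
suff [b be H] : exists2 b, (b <= 2 * (2 * e * e * e) + 1)%N &
    (\sum_(p <- P) \sum_(q <- Q) asb (Y (pt_of p q)) <= (e + b) * (size P + size Q))%N.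
  by apply: leq_trans H _; rewrite leq_mul2r /component_const -addnA leq_add2l be orbT.
case: k k2 cY nY de {dY} => [_ _ nY de|[_ cY nY de|[_ cY nY de|//]]].
- exists 0%N => //; apply: (@sum_bad_rows _ _ _ (fun=> False)) => // [p _|L _ HL]; last first.
    by case: L HL => // p L /(_ p (mem_head _ _)).
  apply: count_image => // s us Hs.
  apply: (irr_degree_bound (A := 0) (b := 0) (S := Y) de) => //.
  + by rewrite mxrank0.
  + by move=> x; split=> [Yx|[]//]; split=> //; apply/matrixP => -[].
  + exists [:: v0] => x Yx; rewrite inE; apply/eqP; apply: NNPP => ne; apply: nY.
    exact: irreducible_chain_in1 iY Yx Yv0 ne.
  + by move=> x /Hs [].
- exists 1%N; first by lia.
  (* A row is bad when the whole curve lies over [p], which happens for one [p] at most. Otherwise a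
     coordinate hyperplane containing all points over [p] cuts [Y] properly, hence in finitely many
     points. *)
  apply: (@sum_bad_rows _ _ _ 
    (fun p => forall v, Y v -> v 0 i0 = p.1 /\ v 0 i1 = p.2)) => // [p nbad|L uL HL].
    have [i [c [[v Yv vc] Hc]]] : exists (i : 'I_4) (c : C), (exists2 v : pt, Y v & v 0 i != c) /\
        forall q, pt_of p q 0 i = c.
      apply: NNPP => no; apply: nbad => v Yv.
      split; apply/eqP/negPn/negP => ne; apply: no.
        by exists i0, p.1; split; [exists v | move=> q; have [] := pt_ofE p q].
      by exists i1, p.2; split; [exists v | move=> q; have [] := pt_ofE p q].
    apply: count_image => // s us Hs; pose S x := Y x /\ x 0 i - c = 0.
    apply: (irr_degree_bound (A := delta_mx 0 i) (b := c%:M) (S := S) de) => //.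
    + by rewrite mxrank_delta.
    + move=> x; rewrite aff_sub1 dot_delta /S; split=> [] [Yx E]; split=> //.
        exact: subr0_eq.
      by rewrite E subrr.
    + apply: (@finite4_proper_section Y) => //.
        by apply: algset_zero => //; apply: pfunD (pfun_coord i) (pfun_const _).
      split; first by move=> x [].
      by exists v; split=> // -[_ /subr0_eq E]; rewrite E eqxx in vc.
    + by move=> x /Hs [Yx [q E]]; split=> //; rewrite E Hc subrr.
  case: L uL HL => [|p [|p' L]] // uL HL; exfalso.
  move: uL; rewrite /= inE negb_or => /andP[/andP[/eqP pp _] _].
  apply: pp; have [E1 E2] := HL p (mem_head _ _) v0 Yv0.
  have [|E3 E4] := HL p' _ v0 Yv0; first by rewrite !inE eqxx orbT.
  by rewrite [p]surjective_pairing [p']surjective_pairing -E1 -E2 -E3 -E4.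
- exists (2 * (2 * e * e * e))%N; first by lia.
  have u1 : uniq [:: i2; i0; i1; i3] by rewrite /= !inE -!val_eqE /= !inordK.
  have u2 : uniq [:: i0; i2; i3; i1] by rewrite /= !inE -!val_eqE /= !inordK.
  case: (classic (indep2 Y i0 i1)) => [ind|d01].
    apply: (@sum_bad_rows _ _ _ (fun p => ~ finite4 (fib Y i0 i1 p))) => // [p /NNPP fin|L uL HL].
      apply: count_image => // s us Hs.
      apply: (@irr_degree2_coord Y e i0 i1 p.1 p.2) => //.
        by rewrite -val_eqE /= !inordK.
      by move=> x /Hs [Yx [q E]]; split=> //; rewrite E; have [-> -> _ _] := pt_ofE p q.
    exact: (dim2_few_contracted iY u1 de nY ind).
  case: (classic (indep2 Y i2 i3)) => [ind|d23].
    (* With s, t independent the projection to the second plane is used, so [P] and [Q] exchange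
       roles. *)
    rewrite exchange_big [(size P + _)%N]addnC.
    apply: (@sum_bad_rows _ _ (fun q p => asb (Y (pt_of p q)))
      (fun p => ~ finite4 (fib Y i2 i3 p))) => // [q /NNPP fin|L uL HL].
      apply: (@count_image _ (pt_of^~ q)) => // s us Hs.
      apply: (@irr_degree2_coord Y e i2 i3 q.1 q.2) => //.
        by rewrite -val_eqE /= !inordK.
      by move=> x /Hs [Yx [p E]]; split=> //; rewrite E; have [_ _ -> ->] := pt_ofE p q.
    exact: (dim2_few_contracted iY u2 de nY ind).
  by exfalso; apply: ncart; apply: (cartesian_of_dependent iY sYX cY).
Qed.

Lemma incidences_sum fs (P Q : seq (C * C)) :
  incidences fs P Q = (\sum_(p <- P) \sum_(q <- Q) all (fun f => peval f (pt_of p q) == 0%R) fs)%N.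
Proof.
rewrite /incidences -sum1_count [LHS]big_mkcond big_allpairs_dep /=.
by apply: eq_bigr => p _; apply: eq_bigr => q _; case: all.
Qed.

Theorem theorem1p2 :
  forall d : nat, exists c : nat,
  forall (fs : seq {mpoly C[4]}) (P Q : seq (C * C)),
    uniq P -> uniq Q ->
    has_degree (zero_set fs) d ->
    (has_dim (zero_set fs) 1 \/ has_dim (zero_set fs) 2) ->
    ~ cartesian (zero_set fs) ->
    (incidences fs P Q <= c * (size P + size Q))%N.
Proof.
(* Component degrees are positive and add up to [d]: there are at most [d] components, each of
   degree at most [d]. *)
move=> d; exists (d * component_const d)%N => fs P Q uP uQ [n [Y [k [e [HY EX _ Ed]]]]] dimX ncart.
have nX : ~ chain_in (zero_set fs) 3.
  by case: dimX => -[_ nX] // /(chain_in_le (isT : (2 <= 3)%N)).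
have sYX i : (i < n)%N -> subset4 (Y i) (zero_set fs) by move=> lt x Yx; apply/EX; exists i.
have k2 i : (i < n)%N -> (k i <= 2)%N.
  move=> lt; rewrite leqNgt; apply/negP => k3; have [_ [[cY _] _]] := HY i lt.
  by apply: nX; apply: chain_in_sub (sYX i lt) _; apply: chain_in_le cY.
have e_gt0 i : (i < n)%N -> (0 < e i)%N.
  by move=> lt; have [iY [dY deY]] := HY i lt; apply: irr_degree_gt0 deY (k2 i lt).
have nd : (n <= d)%N.
  rewrite Ed -[n in (n <= _)%N]card_ord -sum1_card; apply: leq_sum => i _; exact: e_gt0.
have ed i : (i < n)%N -> (e i <= d)%N.
  by move=> lt; rewrite Ed (bigD1 (Ordinal lt)) //= leq_addr.
rewrite incidences_sum.
apply: (@leq_trans (\sum_(i < n) \sum_(p <- P) \sum_(q <- Q) asb (Y i (pt_of p q)))).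
  rewrite [X in (_ <= X)%N]exchange_big /=; apply: leq_sum => p _.
  rewrite [X in (_ <= X)%N]exchange_big /=; apply: leq_sum => q _.
  case: (boolP (all _ _)) => // /EX [i lt Yi].
  by rewrite (bigD1 (Ordinal lt)) //=; case: asbP.
apply: (@leq_trans (\sum_(i < n) component_const d * (size P + size Q))).
  apply: leq_sum => i _; have lt := ltn_ord i; have [iY [dY deY]] := HY i lt.
  apply: leq_trans (component_bound iY dY deY (k2 i lt) (sYX i lt) ncart uP uQ) _.
  by rewrite leq_mul2r component_const_le ?orbT // ed.
by rewrite sum_nat_const card_ord -mulnA leq_mul2r nd orbT.
Qed.
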